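(* Let $m\ge 1$ and let $f$ be a continuous probability density function on the unit hypersphere $S^m=\{x\in\mathbb{R}^{m+1}:\|x\|_2=1\}$ (i.e. $f\ge 0$ is continuous and $\int_{S^m} f\,d\omega_m=1$, where $\omega_m$ is the surface measure on $S^m$). Then for every $\delta>0$ there exist positive integers $n$ and $N$, points $y_1,\dots,y_N\in S^m$, and real numbers $c_1,\dots,c_N$ with $c_k>0$ for all $k$ and $\sum_{k=1}^N c_k=1$, such that $$\max_{x\in S^m}\Big|f(x)-\sum_{k=1}^N c_k K_n(\langle x,y_k\rangle)\Big|<\delta,$$ where $K_n(t)=c_{m+1}(n)\,e^{nt}$ for $t\in[-1,1]$. In other words, $f$ is uniformly approximated within $\delta$ by a finite mixture of von Mises–Fisher densities on $S^m$ with mean directions $y_k$ and common concentration parameter $n$.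
   Context: $\langle\cdot,\cdot\rangle$ is the standard inner product on $\mathbb{R}^{m+1}$. For $\kappa>0$, the normalizing constant of the von Mises–Fisher distribution is $c_{m+1}(\kappa)=\dfrac{\kappa^{\frac{m+1}{2}-1}}{(2\pi)^{\frac{m+1}{2}} I_{\frac{m+1}{2}-1}(\kappa)}$, where $I_v$ is the modified Bessel function of the first kind of order $v$; with this constant, for each $\mu\in S^m$ the function $x\mapsto c_{m+1}(\kappa)\exp(\kappa\langle x,\mu\rangle)$ is a probability density on $S^m$ with respect to the surface measure $\omega_m$ (the von Mises–Fisher density with mean direction $\mu$ and concentration $\kappa$). *)

(* Defs.v *)
From HB Require Import structures.
From mathcomp Require Import all_boot all_order all_algebra.
From mathcomp Require Import all_classical all_reals all_analysis.
Set Implicit Arguments. Unset Strict Implicit. Unset Printing Implicit Defensive.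
Import Order.TTheory GRing.Theory Num.Theory.
Import numFieldNormedType.Exports.
Local Open Scope classical_set_scope.
Local Open Scope ring_scope.

Section Defs.
Variable R : realType.

Definition inner (n : nat) (x y : 'rV[R]_n) : R := \sum_(i < n) x 0 i * y 0 i.

Definition norm2 (n : nat) (x : 'rV[R]_n) : R := Num.sqrt (inner x x).

Definition sphere (m : nat) : set 'rV[R]_(m.+1) := [set x | norm2 x = 1].

(* Lebesgue integral over R^n, as an iterated one-dimensional Lebesgue
   integral (Fubini); used only for bounded, compactly supported,
   Borel integrands below. *)
Fixpoint iint (n : nat) : ('rV[R]_n -> R) -> R :=
  match n return ('rV[R]_n -> R) -> R with
  | 0 => fun g => g 0
  | n'.+1 => fun g =>
      Rintegral lebesgue_measure setT
        (fun t : R => iint (fun v : 'rV[R]_n' => g (row_mx (const_mx t : 'rV[R]_1) v : 'rV[R]_(1 + n'))))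
  end.

(* Integral with respect to the surface measure omega_m on S^m, via the
   standard cone construction: omega_m(A) = (m+1) * lambda^(m+1)({r x : 0 < r <= 1, x in A}),
   i.e.  int_{S^m} f d omega_m = (m+1) * int_{0 < |x| <= 1} f(x/|x|) dx. *)
Definition sphere_integral (m : nat) (f : 'rV[R]_(m.+1) -> R) : R :=
  (m.+1)%:R * iint (fun x : 'rV[R]_(m.+1) =>
     if (0 < norm2 x) && (norm2 x <= 1) then f ((norm2 x)^-1 *: x) else 0).

Definition Gamma (s : R) : R :=
  Rintegral lebesgue_measure `]0, +oo[ (fun t : R => t `^ (s - 1) * expR (- t)).

Definition besselI (v x : R) : R :=
  limn (fun N : nat => \sum_(0 <= k < N)
    ((x / 2) `^ (2 * k%:R + v) / ((k`!)%:R * Gamma (k%:R + v + 1)))).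

Definition vmf_const (m : nat) (kappa : R) : R :=
  kappa `^ ((m.+1)%:R / 2 - 1) /
  ((2 * pi) `^ ((m.+1)%:R / 2) * besselI ((m.+1)%:R / 2 - 1) kappa).

Definition Kn (m n : nat) (t : R) : R := vmf_const m n%:R * expR (n%:R * t).

End Defs.
Arguments sphere {R} m.

(* Main.v *)
(* Let J be the surface integral. Expanding the exponential reduces the
   normalization J(exp (kappa <., mu>)) to the moments J(<., mu>^j). The odd ones
   vanish by x -> -x. For the even ones, writing a power of r times e^(-r^2) as
   an integral over t >= r^2 and using the scaling of balls gives a polar formula
   in which J(<., mu>^(2k)) is multiplied by Gamma(k + (m+1)/2) / 2; the other side,
   the Gaussian integral of <x, mu>^(2k), is computed one coordinate at a time.
   This yields the Bessel series, so [vmf_const] is the inverse of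
   J(exp (kappa <., mu>)) for every mu, without using rotation invariance.

   Since a small cap has positive measure, J(exp (n <., mu>)) grows faster than
   exp (n (1 - eta)), hence the kernels K_n concentrate and K_n * f -> f uniformly.
   A partition of unity psi_k subordinate to a fine net y_k replaces K_n * f by the
   mixture with weights c_k = J(f psi_k), of total mass 1. *)
Require Import Defs.
From HB Require Import structures.
From mathcomp Require Import all_boot all_order all_algebra.
From mathcomp Require Import all_classical all_reals all_analysis.
From mathcomp Require Import measurable_realfun.
From mathcomp Require Import ring lra.
Set Implicit Arguments. Unset Strict Implicit. Unset Printing Implicit Defensive.
Import Order.TTheory GRing.Theory Num.Theory.
Import numFieldNormedType.Exports.
Local Open Scope classical_set_scope.
Local Open Scope ring_scope.

(** * Product Lebesgue measure and row vectors *)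

Section product_space.
Variable R : realType.

(** The surface integral rests on an iterated integral, so it is tied to the coordinates: its
    rotation invariance is hidden, and showing it would take a change of variables under orthogonal
    maps. Yet one constant has to normalize the kernel for every mean direction. The way round is
    that the Gaussian integral of a power of <x, c>, done coordinate by coordinate, sees [c] only
    through the sum of its squared coordinates. Comparison with the Bessel series then gives the
    constant for all directions at once, and this equality of masses is the only form of invariance
    that the convolution argument uses. The Gaussian also supplies the powers of pi, and the factor
    (2k)! / (4^k k!) in its moments stands in for a duplication formula, so that the functional
    equation of Gamma at arguments s >= 1 suffices. *)

Fixpoint rn_disp (n : nat) : measure_display :=
  if n is n'.+1 then
    measure_prod_display (sigma_display (R.-ocitv.-measurable), rn_disp n')
  else default_measure_display.

(** Nested pairs mirror the recursion of [iint], so that each level of the iterated integral is one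
    application of Fubini. Displays nest along with products and have to be computed in parallel. *)
Fixpoint rn (n : nat) : measurableType (rn_disp n) :=
  match n return measurableType (rn_disp n) with
  | 0 => unit : measurableType default_measure_display
  | n'.+1 => (measurableTypeR R * rn n')%type : measurableType _
  end.

Lemma sigma_finite_product_measure1 d1 d2 (T1 : measurableType d1)
    (T2 : measurableType d2) (m1 : {sigma_finite_measure set T1 -> \bar R})
    (m2 : {sigma_finite_measure set T2 -> \bar R}) :
  sigma_finite setT (m1 \x m2)%E.
Proof.
have [F TF Foo] := sigma_finiteT m1; have [G TG Goo] := sigma_finiteT m2.
pose H k := if unpickle k is Some ij then F ij.1 `*` G ij.2 else set0.
exists H.
  apply/seteqP; split=> // -[x y] _.
  have [i _ Fx] : (\bigcup_k F k) x by rewrite -TF.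
  have [j _ Gy] : (\bigcup_k G k) y by rewrite -TG.
  by exists (pickle (i, j)) => //; rewrite /H pickleK.
move=> k; rewrite /H; case: unpickle => [[i j]/=|]; last by rewrite measure0.
have [? ?] := Foo i; have [? ?] := Goo j; split; first exact: measurableX.
by rewrite product_measure1E// lte_mul_pinfty// ge0_fin_numE.
Qed.

(** A separate name to which the sigma-finite instance is attached, so that the construction can be
    iterated. *)
Definition product_measure d1 d2 (T1 : measurableType d1)
    (T2 : measurableType d2) (m1 : {sigma_finite_measure set T1 -> \bar R})
    (m2 : {sigma_finite_measure set T2 -> \bar R}) : set (T1 * T2) -> \bar R :=
  (m1 \x m2)%E.

HB.instance Definition _ d1 d2 (T1 : measurableType d1)
    (T2 : measurableType d2) (m1 : {sigma_finite_measure set T1 -> \bar R})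
    (m2 : {sigma_finite_measure set T2 -> \bar R}) :=
  Measure.on (product_measure m1 m2).

HB.instance Definition _ d1 d2 (T1 : measurableType d1)
    (T2 : measurableType d2) (m1 : {sigma_finite_measure set T1 -> \bar R})
    (m2 : {sigma_finite_measure set T2 -> \bar R}) :=
  Measure_isSigmaFinite.Build _ _ _ (product_measure m1 m2)
    (sigma_finite_product_measure1 m1 m2).

Fixpoint rn_measure (n : nat) : {sigma_finite_measure set (rn n) -> \bar R} :=
  match n return {sigma_finite_measure set (rn n) -> \bar R} with
  | 0 => dirac tt : {sigma_finite_measure set unit -> \bar R}
  | n'.+1 => product_measure (@lebesgue_measure R) (rn_measure n')
  end.

Definition cons_row n (t : R) (v : 'rV[R]_n) : 'rV[R]_n.+1 :=
  row_mx (const_mx t : 'rV[R]_1) v : 'rV[R]_(1 + n).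

Fixpoint rn_row (n : nat) : rn n -> 'rV[R]_n :=
  match n return rn n -> 'rV[R]_n with
  | 0 => fun _ => 0
  | n'.+1 => fun x => cons_row x.1 (rn_row x.2)
  end.

Lemma cons_row0 n t (v : 'rV[R]_n) : cons_row t v 0 0 = t.
Proof.
by rewrite /cons_row mxE; case: splitP => [j _|j /= j0]; rewrite ?mxE.
Qed.

Lemma cons_rowS n t (v : 'rV[R]_n) i : cons_row t v 0 (lift ord0 i) = v 0 i.
Proof.
rewrite /cons_row mxE; case: splitP => [j /=|j /=]; first by rewrite ord1.
by rewrite /bump/= => -[ij]; congr (v _ _); exact/val_inj.
Qed.

Lemma inner_cons_row n s t (u v : 'rV[R]_n) :
  inner (cons_row s u) (cons_row t v) = s * t + inner u v.
Proof.
rewrite /inner big_ord_recl !cons_row0; congr (_ + _).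
by apply: eq_bigr => i _; rewrite !cons_rowS.
Qed.

Lemma scale_cons_row n r t (v : 'rV[R]_n) :
  r *: cons_row t v = cons_row (r * t) (r *: v).
Proof.
apply/rowP => i; rewrite mxE; case: (unliftP ord0 i) => [j ->|->].
  by rewrite !cons_rowS mxE.
by rewrite !cons_row0.
Qed.

Lemma rowK_cons n (x : 'rV[R]_n.+1) :
  x = cons_row (x 0 0) (\row_i x 0 (lift ord0 i)).
Proof.
apply/rowP => i; case: (unliftP ord0 i) => [j ->|->].
  by rewrite !cons_rowS mxE.
by rewrite !cons_row0.
Qed.

Lemma measurable_rn_coord n (i : 'I_n) :
  measurable_fun [set: rn n] (fun x => rn_row x 0 i).
Proof.
elim: n i => [[]//|n ih] i; case: (unliftP ord0 i) => [j ->|->].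
  under eq_fun do rewrite cons_rowS.
  by apply: (measurableT_comp (ih j)); exact: measurable_snd.
under eq_fun do rewrite cons_row0.
exact: measurable_fst.
Qed.

Lemma measurable_rn_ball n (c : 'rV[R]_n) (r : R) :
  measurable (@rn_row n @^-1` ball c r).
Proof.
have [r0|r0] := ltP 0 r; last first.
  rewrite (_ : _ @^-1` _ = set0)//; apply/seteqP; split=> // x /= [].
  by rewrite ltNge r0.
rewrite (_ : _ @^-1` _ = \big[setI/setT]_(i < n)
    ((fun x => rn_row x 0 i) @^-1` (ball (c 0 i) r : set R))); last first.
  rewrite -bigcap_seq; apply/seteqP; split => x /=.
    by move=> [_ cx] i _; exact: cx.
  by move=> cx; split=> // i j; rewrite ord1; exact/cx/mem_index_enum.
apply: bigsetI_measurable => i _.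
rewrite -[X in measurable X]setTI; apply: measurable_rn_coord => //.
exact: measurable_ball.
Qed.

(** The source has a product sigma-algebra and the target a norm topology; second countability links
    them. [U] is the union of the balls inside it with rational centre and radius 1/(k+1), and a
    ball of the sup norm is a finite intersection of coordinate strips. *)
Lemma open_rn_measurable n (U : set 'rV[R]_n) : open U ->
  measurable (@rn_row n @^-1` U).
Proof.
move=> oU.
pose D := [set qk : 'rV[rat]_n * nat |
  ball (map_mx ratr qk.1 : 'rV[R]_n) qk.2.+1%:R^-1 `<=` U].
rewrite (_ : U = \bigcup_(qk in D)
  ball (map_mx ratr qk.1 : 'rV[R]_n) qk.2.+1%:R^-1).
  rewrite preimage_bigcup; rewrite bigcup_mkcond.
  apply: countable_bigcupT_measurable => // qk; case: ifPn => // _.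
  exact: measurable_rn_ball.
apply/seteqP; split=> [x Ux|x [qk Dqk]]; last exact: Dqk.
have [e /= e0 xeU] : nbhs_ball x U by apply/nbhs_ballP; exact: oU.
(* With a radius below [e / 2], any such ball that contains [x] stays within distance [e] of [x]. *)
have [k _ ke] := near_infty_natSinv_lt (PosNum (divr_gt0 e0 (ltr0n R 2))).
have {ke} := ke k (leqnn k) => /= ke.
have k0 : 0 < k.+1%:R^-1 :> R by rewrite invr_gt0.
have qP i : exists q : rat, ball (x 0 i) k.+1%:R^-1 (ratr q : R).
  have : (ball (x 0 i) k.+1%:R^-1 `&` range (@ratr R)) !=set0.
    by apply: dense_rat; [exists (x 0 i); exact: ballxx|exact: ball_open].
  by move=> [y [xy [q _ qy]]]; exists q; rewrite qy.
have xqk : ball (map_mx ratr (\row_i projT1 (cid (qP i))) : 'rV[R]_n)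
    k.+1%:R^-1 x.
  split=> // a b; rewrite ord1 !mxE; apply: ball_sym.
  exact: projT2 (cid (qP b)).
exists (\row_i projT1 (cid (qP i)), k) => //= y qy; apply: xeU => /=.
have := ball_triangle (le_ball (ltW ke) (ball_sym xqk)) (le_ball (ltW ke) qy).
by rewrite -splitr.
Qed.

(** Localized to an open set because x -> g (x / |x|) is in general discontinuous at the origin. *)
Lemma measurable_rn_continuous_in n (U : set 'rV[R]_n) (g : 'rV[R]_n -> R) :
  open U -> (forall x, U x -> {for x, continuous g}) ->
  measurable_fun (@rn_row n @^-1` U) (g \o @rn_row n).
Proof.
move=> oU cg; apply: (measurability _ (RGenOInfty.measurableE R)).
move=> /= _ [_ [a ->] <-].
rewrite (_ : _ `&` _ = @rn_row n @^-1` (U `&` g @^-1` `]a, +oo[)); last first.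
  by [].
apply: open_rn_measurable; rewrite openE => x [Ux gx].
apply: filterI; first exact: oU.
have : nbhs (g x) `]a, +oo[%classic.
  by apply: open_nbhs_nbhs; split=> //; exact: interval_open.
exact: (cg x Ux).
Qed.

End product_space.

(** * Iterated integrals *)

Section linear_substitution.
Variable R : realType.
Local Notation mu := (@lebesgue_measure R).

Lemma measurable_mull (r : R) :
  measurable_fun [set: measurableTypeR R] ( *%R r : _ -> measurableTypeR R).
Proof. exact: mulrl_measurable. Qed.

(** By uniqueness of Lebesgue measure, it is enough to compare lengths of half-open intervals. *)
Lemma lebesgue_measureM (r : R) (A : set (measurableTypeR R)) : 0 < r ->
  measurable A ->
  (r%:E * pushforward mu ( *%R r : _ -> measurableTypeR R) A = mu A)%E.
Proof.
move=> r0 mA.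
pose nu := mscale (NngNum (ltW r0))
  (pushforward mu ( *%R r : _ -> measurableTypeR R)).
apply/esym; apply: (@lebesgue_measure_unique _ (nu (measurable_mull r))) => //= _ [[a b]] _ <-.
rewrite /nu /mscale/= /pushforward.
rewrite (_ : _ @^-1` _ = `](r^-1 * a), (r^-1 * b)]%classic); last first.
  by apply/seteqP; split => x /=; rewrite !in_itv/= ltr_pdivrMl// ler_pdivlMl.
rewrite !lebesgue_measure_itv/= !lte_fin ltr_pM2l ?invr_gt0//.
case: ifPn => _; last by rewrite mule0.
by rewrite -EFinM -mulrBr mulrA divff ?mul1r ?gt_eqF.
Qed.

Lemma ge0_integral_mull (r : R) (h : R -> \bar R) : 0 < r ->
  measurable_fun [set: measurableTypeR R] h -> (forall t, 0 <= h t)%E ->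
  (\int[mu]_t h (r * t)%R = r^-1%:E * \int[mu]_t h t)%E.
Proof.
move=> r0 mh h0.
pose nu := mscale (NngNum (ltW r0))
  (pushforward mu ( *%R r : _ -> measurableTypeR R)).
have -> : (\int[mu]_t h t = \int[nu (measurable_mull r)]_t h t)%E.
  by apply: eq_measure_integral => A mA _; exact/esym/lebesgue_measureM.
rewrite ge0_integral_mscale//= ge0_integral_pushforward//.
by rewrite preimage_setT muleA -EFinM mulVf ?gt_eqF// mul1e.
Qed.

Lemma ge0_integral_opp (h : R -> \bar R) :
  measurable_fun [set: measurableTypeR R] h -> (forall t, 0 <= h t)%E ->
  (\int[mu]_t h (- t)%R = \int[mu]_t h t)%E.
Proof.
move=> mh h0.
transitivity (\int[mu]_(t in (-%R : _ -> measurableTypeR R) @^-1` setT)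
  (h \o (-%R : _ -> measurableTypeR R)) t)%E; first by rewrite preimage_setT.
rewrite -ge0_integral_pushforward//.
by apply: eq_measure_integral => //= A mA AS; exact: lebesgue_measureN.
Qed.

Lemma Rintegral_mull (r : R) (h : R -> R) : 0 < r ->
  measurable_fun [set: measurableTypeR R] h ->
  \int[mu]_t h (r * t) = r^-1 * \int[mu]_t h t.
Proof.
move=> r0 mh; have mEh := (measurable_EFinP _ _).2 mh.
rewrite /Rintegral integralE [in RHS]integralE.
set x := (X in r^-1 * fine (X - _)); set y := (X in r^-1 * fine (_ - X)).
transitivity (fine (r^-1%:E * x - r^-1%:E * y)).
  congr (fine (_ - _)).
    transitivity (\int[mu]_t (EFin \o h)^\+ (r * t)%R)%E.
      by apply: eq_integral => t _; rewrite !funeposE.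
    by rewrite ge0_integral_mull//; exact: measurable_funepos.
  transitivity (\int[mu]_t (EFin \o h)^\- (r * t)%R)%E.
    by apply: eq_integral => t _; rewrite !funenegE.
  by rewrite ge0_integral_mull//; exact: measurable_funeneg.
have x0 : (0 <= x)%E by exact: integral_ge0.
have y0 : (0 <= y)%E by exact: integral_ge0.
have ri : 0 < r^-1 by rewrite invr_gt0.
(* If the positive or the negative part has infinite integral, [fine] returns 0 on both sides. *)
clearbody x y; move: x y x0 y0 => [x| |] [y| |]//= _ _; rewrite ?mulrBr//;
  by rewrite ?gt0_muley ?lte_fin//= ?mulr0.
Qed.

Lemma Rintegral_opp (h : R -> R) : measurable_fun [set: measurableTypeR R] h ->
  \int[mu]_t h (- t) = \int[mu]_t h t.
Proof.
move=> mh; have mEh := (measurable_EFinP _ _).2 mh.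
rewrite /Rintegral integralE [in RHS]integralE; congr (fine (_ - _)).
  transitivity (\int[mu]_t (EFin \o h)^\+ (- t)%R)%E.
    by apply: eq_integral => t _; rewrite !funeposE.
  by rewrite ge0_integral_opp//; exact: measurable_funepos.
transitivity (\int[mu]_t (EFin \o h)^\- (- t)%R)%E.
  by apply: eq_integral => t _; rewrite !funenegE.
by rewrite ge0_integral_opp//; exact: measurable_funeneg.
Qed.

End linear_substitution.

(** * Fubini and linear substitutions for Gaussian-dominated integrands *)

Section iterated_integral.
Variable R : realType.
Local Notation mu := (@lebesgue_measure R).

Lemma inner_ge0 n (x : 'rV[R]_n) : 0 <= inner x x.
Proof. by apply: sumr_ge0 => i _; rewrite -expr2 sqr_ge0. Qed.

Lemma measurable_inner n (c : 'rV[R]_n) :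
  measurable_fun [set: rn R n] (fun x => inner (rn_row x) c).
Proof.
apply: measurable_sum => i; apply: measurable_funM => //.
exact: measurable_rn_coord.
Qed.

Lemma measurable_sqnorm n :
  measurable_fun [set: rn R n] (fun x => inner (rn_row x) (rn_row x)).
Proof.
by apply: measurable_sum => i; apply: measurable_funM; exact: measurable_rn_coord.
Qed.

(** The exponent is half of that in the Gaussian exp (-|x|^2) integrated later, so a polynomial
    times that Gaussian is still dominated by a multiple of [wexp]. *)
Definition wexp n (x : 'rV[R]_n) := expR (- (inner x x / 2)).

Lemma measurable_wexp n : measurable_fun [set: rn R n] (@wexp n \o @rn_row R n).
Proof.
apply: measurableT_comp => //; apply: measurableT_comp => //.
by apply: measurable_funM => //; exact: measurable_sqnorm.
Qed.

Lemma wexp_cons n t (v : 'rV[R]_n) :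
  wexp (cons_row t v) = expR (- (t ^+ 2 / 2)) * wexp v.
Proof. by rewrite /wexp inner_cons_row -expRD -expr2; congr expR; lra. Qed.

Lemma integral_wexp1 : (\int[mu]_t (expR (- (t ^+ 2 / 2)))%:E < +oo)%E.
Proof.
pose r := Num.sqrt (2^-1 : R); have r0 : 0 < r by rewrite sqrtr_gt0.
under eq_integral.
  move=> t _; rewrite (_ : - (t ^+ 2 / 2) = - (r * t) ^+ 2); last first.
    by rewrite exprMn sqr_sqrtr// mulrC.
  over.
rewrite (ge0_integral_mull (h := EFin \o (@gauss_fun R)))//.
- by rewrite integralT_gauss -EFinM ltry.
- by apply/measurable_EFinP; exact: measurable_gauss_fun.
- by move=> t; rewrite lee_fin gauss_fun_ge0.
Qed.

Lemma integral_wexp n : (\int[rn_measure R n]_x (wexp (rn_row x))%:E < +oo)%E.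
Proof.
elim: n => [|n ih] /=.
  by rewrite integral_dirac// diracT mul1e ltry.
rewrite [X in (X < _)%E](_ : _ = \int[mu \x rn_measure R n]_x
  (wexp (cons_row x.1 (rn_row x.2)))%:E)%E//.
rewrite fubini_tonelli1//; last 2 first.
- by apply/measurable_EFinP; exact: (@measurable_wexp n.+1).
- by move=> x; rewrite lee_fin expR_ge0.
rewrite /fubini_F /=.
under eq_integral.
  move=> t _.
  under eq_integral do rewrite wexp_cons EFinM.
  rewrite ge0_integralZl//; last 2 first.
  - by apply/measurable_EFinP; exact: measurable_wexp.
  - by move=> x _; rewrite lee_fin expR_ge0.
  over.
rewrite /= ge0_integralZr//.
- apply: lte_mul_pinfty => //.
  + by apply: integral_ge0 => x _; rewrite lee_fin expR_ge0.
  + rewrite ge0_fin_numE; first exact: integral_wexp1.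
    by apply: integral_ge0 => x _; rewrite lee_fin expR_ge0.
- apply/measurable_EFinP; apply: measurableT_comp => //.
  by apply: measurableT_comp => //; apply: measurable_funM.
- by apply: integral_ge0 => x _; rewrite lee_fin expR_ge0.
Qed.

(* Every integrand below is measurable and dominated by a Gaussian; unlike
   integrability, this class is stable under taking all (not only almost all)
   sections, so [iint] can be unfolded by Fubini at each level. *)
Definition gdom n (g : 'rV[R]_n -> R) :=
  measurable_fun [set: rn R n] (g \o @rn_row R n) /\
  exists C, forall x, `|g x| <= C * wexp x.

Lemma gdom_integrable n (g : 'rV[R]_n -> R) : gdom g ->
  (rn_measure R n).-integrable setT (EFin \o (g \o @rn_row R n)).
Proof.
move=> [mg [C gC]].
apply: (@le_integrable _ _ _ _ _ _ _
  (fun x => C%:E * (EFin \o (@wexp n \o @rn_row R n)) x)%E) => //.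
- exact/measurable_EFinP.
- move=> x _ /=; rewrite lee_fin (le_trans (gC _))//.
  by rewrite ler_norm.
- apply: integrableZl => //; apply/integrableP; split.
    by apply/measurable_EFinP; exact: measurable_wexp.
  apply: le_lt_trans (integral_wexp n); rewrite le_eqVlt; apply/orP; left.
  by apply/eqP; apply: eq_integral => x _ /=; rewrite ger0_norm ?expR_ge0.
Qed.

Lemma gdom_section n (g : 'rV[R]_n.+1 -> R) t : gdom g ->
  gdom (fun v => g (cons_row t v)).
Proof.
move=> [mg [C gC]]; split.
  exact: (measurableT_comp mg (@pair1_measurable _ _ (measurableTypeR R) (rn R n) t)).
exists (C * expR (- (t ^+ 2 / 2))) => v.
by rewrite -mulrA -wexp_cons; exact: gC.
Qed.

Lemma iint_integral n (g : 'rV[R]_n -> R) : gdom g ->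
  iint g = \int[rn_measure R n]_x g (rn_row x).
Proof.
elim: n g => [|n ih] g gg /=.
  by rewrite /Rintegral integral_dirac// diracT mul1e.
under eq_Rintegral do rewrite -/(cons_row _ _) (ih _ (gdom_section _ gg)).
have gi := gdom_integrable gg.
(* Every section is dominated, so the inner extended integral is finite for each [t] and [fine]
   loses nothing. *)
rewrite {1}/Rintegral; transitivity (fine (\int[mu]_t
    fubini_F (rn_measure R n) (EFin \o (g \o @rn_row R n.+1)) t)).
  congr fine; apply: eq_integral => t _; rewrite fineK//.
  exact: (integrable_fin_num _ (gdom_integrable (gdom_section t gg))).
by rewrite (integral12_prod_meas1 gi).
Qed.

Lemma measurable_iint_section n (g : 'rV[R]_n.+1 -> R) : gdom g ->
  measurable_fun [set: measurableTypeR R] (fun t => iint (fun v => g (cons_row t v))).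
Proof.
move=> gg; have gi := gdom_integrable gg.
rewrite [X in measurable_fun _ X](_ : _ =
  fine \o fubini_F (rn_measure R n) (EFin \o (g \o @rn_row R n.+1))).
  by apply: measurableT_comp => //; exact: (measurable_fubini_F gi).
by apply/funext => t; rewrite (iint_integral (gdom_section _ gg)).
Qed.

Lemma integral_iint n (g : 'rV[R]_n -> R) : gdom g ->
  (\int[rn_measure R n]_x (g (rn_row x))%:E = (iint g)%:E)%E.
Proof.
move=> gg; rewrite iint_integral// /Rintegral fineK//.
exact: integrable_fin_num (gdom_integrable gg).
Qed.

Lemma gdomD n (f g : 'rV[R]_n -> R) : gdom f -> gdom g ->
  gdom (fun x => f x + g x).
Proof.
move=> [mf [C fC]] [mg [D gD]]; split; first exact: measurable_funD.
exists (C + D) => x; rewrite mulrDl (le_trans (ler_normD _ _))//.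
exact: lerD.
Qed.

Lemma gdomZ n c (g : 'rV[R]_n -> R) : gdom g -> gdom (fun x => c * g x).
Proof.
move=> [mg [D gD]]; split; first exact: measurable_funM.
by exists (`|c| * D) => x; rewrite normrM -mulrA ler_wpM2l.
Qed.

Lemma iintD n (f g : 'rV[R]_n -> R) : gdom f -> gdom g ->
  iint (fun x => f x + g x) = iint f + iint g.
Proof.
move=> gf gg; rewrite !iint_integral//; last exact: gdomD.
by rewrite RintegralD//; exact: gdom_integrable.
Qed.

Lemma iintZ n c (g : 'rV[R]_n -> R) : gdom g ->
  iint (fun x => c * g x) = c * iint g.
Proof.
move=> gg; rewrite !iint_integral//; last exact: gdomZ.
by rewrite RintegralZl//; exact: gdom_integrable.
Qed.

Lemma le_iint n (f g : 'rV[R]_n -> R) : gdom f -> gdom g ->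
  (forall x, f x <= g x) -> iint f <= iint g.
Proof.
move=> gf gg fg; rewrite !iint_integral//.
by apply: le_Rintegral => //; exact: gdom_integrable.
Qed.

Lemma eq_iint n (f g : 'rV[R]_n -> R) : f =1 g -> iint f = iint g.
Proof. by move=> /funext ->. Qed.

(** The one-dimensional rule is taken as a hypothesis so that dilations (c = 1/r) and the reflection
    (r = -1, c = 1) share one induction over the coordinates. *)
Lemma iint_linear_substitution (r c : R) n (g : 'rV[R]_n -> R) :
  (forall h : R -> R, measurable_fun [set: measurableTypeR R] h ->
     \int[mu]_t h (r * t) = c * \int[mu]_t h t) ->
  gdom g -> iint (fun x => g (r *: x)) = c ^+ n * iint g.
Proof.
move=> hr; elim: n g => [|n ih] g gg /=; first by rewrite scaler0 mul1r.
under eq_Rintegral => t _.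
  rewrite (_ : (fun v => _) = fun v => g (cons_row (r * t) (r *: v))); last first.
    by apply/funext => v; rewrite -scale_cons_row.
  rewrite (ih _ (gdom_section _ gg)).
  over.
rewrite (hr (fun t => c ^+ n * iint (fun v => g (cons_row t v)))); last first.
  by apply: measurable_funM => //; exact: measurable_iint_section.
rewrite exprS -mulrA; congr (_ * _).
rewrite RintegralZl//.
rewrite (_ : EFin \o _ = fubini_F (rn_measure R n) (EFin \o (g \o @rn_row R n.+1))).
  exact: (integrable_fubini_F (gdom_integrable gg)).
apply/funext => t /=; rewrite (iint_integral (gdom_section _ gg)).
rewrite /Rintegral fineK//.
exact: (integrable_fin_num _ (gdom_integrable (gdom_section t gg))).
Qed.

Lemma iint_scale (r : R) n (g : 'rV[R]_n -> R) : 0 < r -> gdom g ->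
  iint (fun x => g (r *: x)) = r ^- n * iint g.
Proof.
move=> r0 gg; rewrite -exprVn; apply: iint_linear_substitution => // h mh.
exact: Rintegral_mull.
Qed.

Lemma iint_opp n (g : 'rV[R]_n -> R) : gdom g ->
  iint (fun x => g (- x)) = iint g.
Proof.
move=> gg; under eq_fun do rewrite -scaleN1r.
rewrite (@iint_linear_substitution (-1) 1)// ?expr1n ?mul1r// => h mh.
by under eq_Rintegral do rewrite mulN1r; rewrite Rintegral_opp ?mul1r.
Qed.

(** A function supported at the origin is invariant under x -> 2x, whereas its integral gets
    multiplied by 2^(-n); the integral must be 0. *)
Lemma iint0 n (g : 'rV[R]_n -> R) : gdom g -> (0 < n)%N ->
  (forall x, x != 0 -> g x = 0) -> iint g = 0.
Proof.
move=> gg n0 g0; have r0 : 0 < 2 :> R by [].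
have : iint (fun x => g (2 *: x)) = iint g.
  apply: eq_iint => x; have [->|x0] := eqVneq x 0; first by rewrite scaler0.
  by rewrite !g0// scaler_eq0 negb_or x0 andbT.
rewrite iint_scale// => /eqP; rewrite -subr_eq0 -{2}[iint g]mul1r -mulrBl.
rewrite mulf_eq0 subr_eq0 => /orP[/eqP r1|/eqP//].
have : (2 : R) ^+ n = 1 by rewrite -[LHS]invrK r1 invr1.
by move/eqP; rewrite -natrX (eqr_nat R _ 1) -(expn0 2) eqn_exp2l// gtn_eqF.
Qed.

End iterated_integral.

(** * The surface integral as a positive linear functional *)

Local Arguments rn_disp : simpl never.
Local Arguments rn : simpl never.
Local Arguments rn_row : simpl never.
Local Arguments rn_measure : simpl never.
Local Arguments iint : simpl never.

Section sphere_facts.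
Variable R : realType.

Lemma innerC n (x y : 'rV[R]_n) : inner x y = inner y x.
Proof. by apply: eq_bigr => i _; rewrite mulrC. Qed.

Lemma innerZl n r (x y : 'rV[R]_n) : inner (r *: x) y = r * inner x y.
Proof. by rewrite /inner mulr_sumr; apply: eq_bigr => i _; rewrite mxE mulrA. Qed.

Lemma innerZr n r (x y : 'rV[R]_n) : inner x (r *: y) = r * inner x y.
Proof. by rewrite innerC innerZl innerC. Qed.

Lemma innerBl n (x y z : 'rV[R]_n) : inner (x - y) z = inner x z - inner y z.
Proof.
rewrite /inner -sumrB; apply: eq_bigr => i _.
by rewrite !mxE mulrBl.
Qed.

Lemma innerBr n (x y z : 'rV[R]_n) : inner z (x - y) = inner z x - inner z y.
Proof. by rewrite innerC innerBl !(innerC z). Qed.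

Lemma inner_eq0 n (x : 'rV[R]_n) : (inner x x == 0) = (x == 0).
Proof.
apply/idP/eqP => [|->]; last first.
  by rewrite /inner big1// => i _; rewrite mxE mul0r.
rewrite psumr_eq0 => [/allP x0|i _]; last by rewrite -expr2 sqr_ge0.
apply/rowP => i; rewrite mxE; apply/eqP.
by have := x0 i (mem_index_enum _); rewrite /= -expr2 sqrf_eq0.
Qed.

Lemma norm2_ge0 n (x : 'rV[R]_n) : 0 <= norm2 x.
Proof. exact: sqrtr_ge0. Qed.

Lemma sqr_norm2 n (x : 'rV[R]_n) : norm2 x ^+ 2 = inner x x.
Proof. by rewrite sqr_sqrtr// inner_ge0. Qed.

Lemma norm2_eq0 n (x : 'rV[R]_n) : (norm2 x == 0) = (x == 0).
Proof. by rewrite -sqrf_eq0 sqr_norm2 inner_eq0. Qed.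

Lemma norm2_gt0 n (x : 'rV[R]_n) : (0 < norm2 x) = (x != 0).
Proof. by rewrite lt_neqAle norm2_ge0 andbT eq_sym norm2_eq0. Qed.

Lemma norm2Z n r (x : 'rV[R]_n) : norm2 (r *: x) = `|r| * norm2 x.
Proof.
by rewrite /norm2 innerZl innerZr mulrA -expr2 sqrtrM ?sqr_ge0// sqrtr_sqr.
Qed.

Lemma sphereE m (x : 'rV[R]_m.+1) : sphere m x <-> inner x x = 1.
Proof.
rewrite /sphere/= -sqr_norm2; split=> [->|/eqP]; first by rewrite expr1n.
by rewrite sqrp_eq1 ?norm2_ge0// => /eqP.
Qed.

Lemma sphere_normalize m (x : 'rV[R]_m.+1) :
  x != 0 -> sphere m ((norm2 x)^-1 *: x).
Proof.
rewrite -norm2_gt0 => x0; rewrite /sphere/= norm2Z ger0_norm ?invr_ge0 ?norm2_ge0//.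
by rewrite mulVf ?gt_eqF.
Qed.

(* Cauchy-Schwarz on the sphere, from |x - y|^2 >= 0 and |x + y|^2 >= 0. *)
Lemma inner_sphere m (x y : 'rV[R]_m.+1) : sphere m x -> sphere m y ->
  `|inner x y| <= 1.
Proof.
move=> /sphereE xx /sphereE yy.
have := inner_ge0 (x - y); have := inner_ge0 (x - (- 1) *: y).
rewrite !innerBl !innerBr !innerZl !innerZr xx yy (innerC y x) => h1 h2.
by rewrite ler_norml; apply/andP; split; lra.
Qed.

Lemma continuous_sum_ord (T : topologicalType) n (F : 'I_n -> T -> R) :
  (forall i, continuous (F i)) -> continuous (fun x => \sum_(i < n) F i x).
Proof.
elim: n F => [|n ih] F cF x.
  by under eq_fun do rewrite big_ord0; exact: cvg_cst.
under eq_fun do rewrite big_ord_recr; apply: cvgD; last exact: cF.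
by apply: ih => i; exact: cF.
Qed.

Lemma inner_continuous n (c : 'rV[R]_n) : continuous (fun x : 'rV[R]_n => inner x c).
Proof.
apply: continuous_sum_ord => i x.
apply: (@continuousM _ _ (fun y : 'rV[R]_n => y 0 i) (fun=> c 0 i)).
  exact: coord_continuous.
exact: cst_continuous.
Qed.

Lemma sqnorm_continuous n : continuous (fun x : 'rV[R]_n => inner x x).
Proof.
apply: continuous_sum_ord => i x.
by apply: (@continuousM _ _ (fun y : 'rV[R]_n => y 0 i)); exact: coord_continuous.
Qed.

Lemma norm2_continuous n : continuous (@norm2 R n).
Proof.
move=> x; apply: (@continuous_comp _ _ _ (fun x => inner x x) Num.sqrt).
  exact: sqnorm_continuous.
exact: sqrt_continuous.
Qed.

Lemma normalize_continuous n (x : 'rV[R]_n) : x != 0 ->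
  {for x, continuous (fun y : 'rV[R]_n => (norm2 y)^-1 *: y)}.
Proof.
move=> x0.
apply: (@continuousZ R _ _ (fun y : 'rV[R]_n => (norm2 y)^-1) idfun) => //.
by apply: continuousV; [rewrite norm2_eq0|exact: norm2_continuous].
Qed.

Lemma coord_le_norm2 n (x : 'rV[R]_n) i : `|x 0 i| <= norm2 x.
Proof.
rewrite -ler_sqr ?nnegrE ?norm2_ge0// real_normK ?num_real// sqr_norm2.
rewrite /inner (bigD1 i)//= expr2 lerDl; apply: sumr_ge0 => j _.
by rewrite -expr2 sqr_ge0.
Qed.

Lemma mx_norm_le_norm2 n (x : 'rV[R]_n) : `|x| <= norm2 x.
Proof.
rewrite [leLHS]/Num.norm/= mx_normrE; apply/bigmax_leP; split; first exact: norm2_ge0.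
by move=> [i j] _ /=; rewrite ord1; exact: coord_le_norm2.
Qed.

Lemma sphere_compact m : compact (@sphere R m).
Proof.
apply: bounded_closed_compact.
  exists 1; split=> // r r1 x xS; apply: (le_trans (mx_norm_le_norm2 x)).
  by rewrite xS ltW.
rewrite (_ : sphere m = (@norm2 R m.+1) @^-1` [set 1])//.
apply: closed_comp => [x _|]; first exact: norm2_continuous.
exact: closed_eq.
Qed.

(** * Radial extension and the class of integrands on the sphere *)

Lemma measurable_sqnorm_le n t :
  measurable_fun [set: rn R n] (fun x => inner (rn_row x) (rn_row x) <= t).
Proof. by apply: measurable_fun_ler => //; exact: measurable_sqnorm. Qed.

Lemma measurable_row_neq0 n :
  measurable_fun [set: rn R n] (fun x => rn_row x != 0).
Proof.
rewrite (_ : (fun _ => _) = fun x : rn R n => 0 < inner (rn_row x) (rn_row x)).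
  by apply: measurable_fun_ltr => //; exact: measurable_sqnorm.
by apply/funext => x; rewrite lt_def inner_ge0 andbT inner_eq0.
Qed.

Definition radial_ext m (g : 'rV[R]_m.+1 -> R) (x : 'rV[R]_m.+1) : R :=
  if x != 0 then g ((norm2 x)^-1 *: x) else 0.

(** The parameter bounds the squared radius: it is the variable of the layer-cake formula, where the
    Gaussian weight becomes exp (-t). *)
Definition ball_ext m (t : R) (g : 'rV[R]_m.+1 -> R) (x : 'rV[R]_m.+1) : R :=
  if inner x x <= t then radial_ext g x else 0.

(** Measurability is asked of the radial extension, which is what the cone construction integrates,
    while the bound concerns the sphere only. The class contains the functions continuous on the
    sphere and is closed under the algebraic operations and the exponential. *)
Definition sbounded m (g : 'rV[R]_m.+1 -> R) :=
  measurable_fun [set: rn R m.+1] (radial_ext g \o @rn_row R m.+1) /\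
  exists C, forall x, sphere m x -> `|g x| <= C.

Lemma sbounded_radial_ext m (g : 'rV[R]_m.+1 -> R) : sbounded g ->
  exists2 C, 0 <= C & forall x, `|radial_ext g x| <= C.
Proof.
move=> [_ [C gC]]; exists `|C| => // x; rewrite /radial_ext.
case: ifPn => [x0|_]; last by rewrite normr0.
exact: le_trans (gC _ (sphere_normalize x0)) (ler_norm _).
Qed.

Lemma sbounded_gdom m t (g : 'rV[R]_m.+1 -> R) :
  sbounded g -> gdom (ball_ext t g).
Proof.
move=> bg; have [C C0 gC] := sbounded_radial_ext bg; split.
  apply: measurable_fun_ifT => //; last exact: bg.1.
  exact: measurable_sqnorm_le.
(* Where |x|^2 <= t the weight [wexp x] is at least exp (-t/2). *)
exists (C * expR (t / 2)) => x.
rewrite /ball_ext; case: ifPn => [xt|_]; last first.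
  by rewrite normr0 !mulr_ge0// expR_ge0.
rewrite -mulrA (le_trans (gC _))// ler_peMr//.
rewrite /wexp -expRD leNgt expR_lt1 -leNgt; lra.
Qed.

Lemma sphere_integralE m (g : 'rV[R]_m.+1 -> R) :
  sphere_integral g = m.+1%:R * iint (ball_ext 1 g).
Proof.
congr (_ * _); apply: eq_iint => x; rewrite /ball_ext /radial_ext norm2_gt0.
rewrite -sqr_norm2 expr_le1 ?norm2_ge0//.
by case: (x != 0); case: (norm2 x <= 1).
Qed.

(** An arbitrary relation [P] lets equality and comparison of integrals come from the same case
    analysis. *)
Lemma ball_extP m (P : R -> R -> Prop) (f g : 'rV[R]_m.+1 -> R) t x :
  P 0 0 -> (forall x, sphere m x -> P (f x) (g x)) ->
  P (ball_ext t f x) (ball_ext t g x).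
Proof.
move=> P0 fg; rewrite /ball_ext /radial_ext; case: ifPn => // _.
by case: ifPn => // x0; exact/fg/sphere_normalize.
Qed.

Lemma eq_sphere_integral m (f g : 'rV[R]_m.+1 -> R) :
  (forall x, sphere m x -> f x = g x) -> sphere_integral f = sphere_integral g.
Proof.
move=> fg; rewrite !sphere_integralE; congr (_ * _); apply: eq_iint => x.
exact: (ball_extP (P := @eq R)).
Qed.

Lemma sboundedD m (f g : 'rV[R]_m.+1 -> R) : sbounded f -> sbounded g ->
  sbounded (fun x => f x + g x).
Proof.
move=> [mf [C fC]] [mg [D gD]]; split.
  rewrite (_ : _ \o _ = (radial_ext f \o @rn_row R m.+1) \+
    (radial_ext g \o @rn_row R m.+1)); first exact: measurable_funD.
  by apply/funext => x; rewrite /radial_ext/=; case: ifPn => // _; rewrite addr0.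
exists (C + D) => x xS; rewrite (le_trans (ler_normD _ _))// lerD//.
  exact: fC.
exact: gD.
Qed.

Lemma sboundedM m (f g : 'rV[R]_m.+1 -> R) : sbounded f -> sbounded g ->
  sbounded (fun x => f x * g x).
Proof.
move=> [mf [C fC]] [mg [D gD]]; split.
  rewrite (_ : _ \o _ = (radial_ext f \o @rn_row R m.+1) \*
    (radial_ext g \o @rn_row R m.+1)); first exact: measurable_funM.
  by apply/funext => x; rewrite /radial_ext/=; case: ifPn => // _; rewrite mulr0.
exists (C * D) => x xS; rewrite normrM ler_pM//.
  exact: fC.
exact: gD.
Qed.

Lemma sbounded_continuous m (g : 'rV[R]_m.+1 -> R) :
  {within sphere m, continuous g} -> sbounded g.
Proof.
move=> cg; split; last first.
  have /compact_bounded[M [_ gM]] := continuous_compact cg (@sphere_compact m).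
  exists (M + 1) => x xS; apply: (gM (M + 1)); first by rewrite ltrDl.
  by exists x.
pose U := [set x : 'rV[R]_m.+1 | x != 0].
have oU : open U.
  rewrite (_ : U = (@norm2 R m.+1) @^-1` [set r | 0 < r]).
    apply: open_comp => [x _|]; first exact: norm2_continuous.
    exact: open_gt.
  by apply/seteqP; split=> x; rewrite /U/= norm2_gt0.
pose D : set (rn R m.+1) := (@rn_row R m.+1) @^-1` U.
have mD : measurable D by exact: open_rn_measurable.
rewrite (_ : _ \o _ =
  ((fun x => g ((norm2 x)^-1 *: x)) \o @rn_row R m.+1) \_ D); last first.
  apply/funext => x /=; rewrite /radial_ext patchE.
  rewrite (_ : (_ != 0) = (x \in D))//; apply/idP/idP.
    by rewrite inE.
  by rewrite inE.
apply/(measurable_restrictT _ mD).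
apply: (@measurable_rn_continuous_in _ _ U (fun x => g ((norm2 x)^-1 *: x))) => //.
move=> x x0.
have xS := sphere_normalize x0.
move/subspace_continuousP : cg => /(_ _ xS) cg.
(* Continuity of [g] is relative to the sphere, which is enough: for y near x, hence nonzero, y /
   |y| is itself on the sphere. *)
move=> A /cg /= wA.
have := normalize_continuous x0 wA; apply: filterS2 (oU x x0) => y y0; apply.
exact: sphere_normalize.
Qed.

Lemma sphere_integralD m (f g : 'rV[R]_m.+1 -> R) : sbounded f -> sbounded g ->
  sphere_integral (fun x => f x + g x) = sphere_integral f + sphere_integral g.
Proof.
move=> bf bg; rewrite !sphere_integralE -mulrDr -iintD; last 2 first.
- exact: sbounded_gdom.
- exact: sbounded_gdom.
congr (_ * _); apply: eq_iint => x; rewrite /ball_ext /radial_ext.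
by case: (inner x x <= 1); case: (x != 0); rewrite ?addr0.
Qed.

Lemma sphere_integralZ m c (g : 'rV[R]_m.+1 -> R) : sbounded g ->
  sphere_integral (fun x => c * g x) = c * sphere_integral g.
Proof.
move=> bg; rewrite !sphere_integralE mulrCA -(iintZ c); last exact: sbounded_gdom.
congr (_ * _); apply: eq_iint => x; rewrite /ball_ext /radial_ext.
by case: (inner x x <= 1); case: (x != 0); rewrite ?mulr0.
Qed.

Lemma le_sphere_integral m (f g : 'rV[R]_m.+1 -> R) : sbounded f -> sbounded g ->
  (forall x, sphere m x -> f x <= g x) -> sphere_integral f <= sphere_integral g.
Proof.
move=> bf bg fg; rewrite !sphere_integralE ler_wpM2l//.
apply: le_iint; [exact: sbounded_gdom|exact: sbounded_gdom|move=> x].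
exact: (ball_extP (P := fun a b => a <= b)).
Qed.

Lemma sbounded_cst m (c : R) : sbounded (fun _ : 'rV[R]_m.+1 => c).
Proof. by apply: sbounded_continuous; apply: continuous_subspaceT => x; exact: cst_continuous. Qed.

Lemma sboundedZ m c (g : 'rV[R]_m.+1 -> R) : sbounded g ->
  sbounded (fun x => c * g x).
Proof. by move=> bg; apply: sboundedM => //; exact: sbounded_cst. Qed.

Lemma sbounded_inner m (c : 'rV[R]_m.+1) : sbounded (fun x => inner x c).
Proof.
apply: sbounded_continuous; apply: continuous_subspaceT.
exact: inner_continuous.
Qed.

Lemma sboundedX m (g : 'rV[R]_m.+1 -> R) k : sbounded g ->
  sbounded (fun x => g x ^+ k).
Proof.
move=> bg; elim: k => [|k ih]; first exact: sbounded_cst.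
by under eq_fun do rewrite exprS; exact: sboundedM.
Qed.

Lemma sbounded_expR m (g : 'rV[R]_m.+1 -> R) : sbounded g ->
  sbounded (fun x => expR (g x)).
Proof.
move=> [mg [C gC]]; split.
  rewrite (_ : _ \o _ = fun x : rn R m.+1 => if rn_row x != 0 then
      expR ((radial_ext g \o @rn_row R m.+1) x) else 0); last first.
    by apply/funext => x /=; rewrite /radial_ext; case: ifPn.
  apply: measurable_fun_ifT => //; first exact: measurable_row_neq0.
  exact: (measurableT_comp (@measurable_expR R) mg).
exists (expR C) => x /gC; rewrite ler_norml => /andP[_ gxC].
by rewrite ger0_norm ?expR_ge0// ler_expR.
Qed.

End sphere_facts.

(** * The Gamma function *)

Section gamma_function.
Variable R : realType.
Local Notation mu := (@lebesgue_measure R).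

(** Kept in the extended reals so that Tonelli applies before finiteness is known. *)
Definition egamma (s : R) : \bar R :=
  (\int[mu]_(t in `]0%R, +oo[) (t `^ (s - 1) * expR (- t))%:E)%E.

Lemma GammaE s : Gamma s = fine (egamma s).
Proof. by []. Qed.

(* [exp_tail k u] is the integral of [t ^+ k * expR (- t)] over t >= u. *)
Fixpoint exp_tail (k : nat) (u : R) : R :=
  if k is k'.+1 then u ^+ k * expR (- u) + k%:R * exp_tail k' u
  else expR (- u).

Lemma is_derive_exp_tail k (u : R) :
  is_derive u 1 (exp_tail k) (- (u ^+ k * expR (- u))).
Proof.
elim: k u => [|k ih] u /=.
  by apply: is_derive_eq; rewrite mulrN1 expr0 mul1r.
have dX : is_derive u 1 (fun v : R => v ^+ k.+1) (k.+1%:R * u ^+ k).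
  rewrite (_ : (fun v => _) = (id : R -> R) ^+ k.+1); last first.
    by apply/funext => v; rewrite fctE.
  by apply: is_derive_eq; rewrite /GRing.scale/= mulr1.
have dE : is_derive u 1 (fun v : R => expR (- v)) (- expR (- u)).
  by apply: is_derive_eq; rewrite mulrN1.
have := is_deriveD (is_deriveM dX dE) (is_deriveZ k.+1%:R (ih u)).
by move/is_derive_eq; apply; rewrite /GRing.scale/=; ring.
Qed.

Lemma continuous_pow_expN k : continuous (fun t : R => t ^+ k * expR (- t)).
Proof.
move=> t; apply: (@continuousM _ _ (fun t : R => t ^+ k) (fun t => expR (- t))).
  exact: exprn_continuous.
apply: (@continuous_comp _ _ _ -%R expR); first exact: opp_continuous.
exact: continuous_expR.
Qed.

Lemma cvg_pow_expN k : (u ^+ k * expR (- u)) @[u --> +oo] --> (0 : R).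
Proof.
apply/cvgrPdist_lt => e e0; near=> u.
have u0 : 0 < u by near: u; exact: nbhs_pinfty_gt.
rewrite sub0r normrN ger0_norm; last by rewrite mulr_ge0 ?expR_ge0// exprn_ge0// ltW.
rewrite expRN ltr_pdivrMr ?expR_gt0//.
(* The term of degree k + 1 in the exponential series already beats [u ^+ k], as soon as u > (k+1)!
   / [e]. *)
apply: (@lt_le_trans _ _ (e * (u ^+ k.+1 / (k.+1)`!%:R))); last first.
  rewrite ler_wpM2l ?(ltW e0)//.
  by apply: le_trans (expR_ge1Dxn k (ltW u0)); rewrite lerDr.
rewrite exprSr -mulrA mulrCA -[ltLHS]mulr1 ltr_pM2l ?exprn_gt0//.
rewrite mulrA ltr_pdivlMr ?mul1r; last by rewrite ltr0n fact_gt0.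
rewrite -ltr_pdivrMl//; near: u; apply: nbhs_pinfty_gt; exact: num_real.
Unshelve. all: by end_near. Qed.

Lemma cvg_exp_tail k : exp_tail k u @[u --> +oo] --> (0 : R).
Proof.
elim: k => [|k ih] /=.
  have := cvg_pow_expN 0; under eq_fun do rewrite expr0 mul1r; exact.
rewrite -(addr0 (0 : R)); apply: cvgD; first exact: (cvg_pow_expN k.+1).
by rewrite -(mulr0 k.+1%:R); apply: cvgM => //; exact: cvg_cst.
Qed.

Lemma integral_exp_tail k (u : R) : 0 <= u ->
  (\int[mu]_(t in `[u, +oo[) (t ^+ k * expR (- t))%:E = (exp_tail k u)%:E)%E.
Proof.
move=> u0.
rewrite (@ge0_continuous_FTC2y _ _ (fun t => - exp_tail k t) u 0).
- by rewrite EFinN sub0e oppeK.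
- by move=> t ut; rewrite mulr_ge0 ?expR_ge0// exprn_ge0// (le_trans u0).
- by apply: continuous_subspaceT; exact: continuous_pow_expN.
- by rewrite -oppr0; apply: cvgN; exact: cvg_exp_tail.
- move=> t ut; apply: derivableN.
  exact: (@ex_derive _ _ _ _ _ _ _ (is_derive_exp_tail k t)).
- apply: cvgN; apply: cvg_at_right_filter.
  apply: differentiable_continuous; apply/derivable1_diffP.
  exact: (@ex_derive _ _ _ _ _ _ _ (is_derive_exp_tail k u)).
- move=> t _; rewrite derive1E deriveN; last first.
    exact: (@ex_derive _ _ _ _ _ _ _ (is_derive_exp_tail k t)).
  by rewrite (@derive_val _ _ _ _ _ _ _ (is_derive_exp_tail k t)) opprK.
Qed.

Lemma egamma_ge0 s : (0 <= egamma s)%E.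
Proof. by apply: integral_ge0 => t _; rewrite lee_fin mulr_ge0 ?powR_ge0 ?expR_ge0. Qed.

Lemma measurable_gamma_integrand s (D : set R) : 
  measurable_fun D (fun t : R => (t `^ s * expR (- t))%:E).
Proof.
apply: (@measurable_funTS _ _ _ _ D); apply/measurable_EFinP; apply: measurable_funM.
  exact: measurable_powR.
by apply: measurableT_comp => //; exact: measurableT_comp.
Qed.

Lemma measurable_EFin_powR (c s : R) (D : set R) :
  measurable_fun D (fun t : R => (c * t `^ s)%:E).
Proof.
apply: (@measurable_funTS _ _ _ _ D); apply/measurable_EFinP; exact: measurable_funM.
Qed.

Lemma egamma_nat k : egamma k.+1%:R = (exp_tail k 0)%:E.
Proof.
rewrite -integral_exp_tail// -integral_itv_obnd_cbnd; last first.
  apply/measurable_EFinP; apply: measurable_funTS.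
  by apply: continuous_measurable_fun; exact: continuous_pow_expN.
apply: eq_integral => t; rewrite inE/= in_itv/= andbT => t0.
by rewrite -natr1 addrK powR_mulrn// ltW.
Qed.

(** For s >= 1 the integrand has no singularity at 0, and t^(s-1) <= 1 + t^k for an integer k >= s -
    1, so Gamma(1) + Gamma(k+1) is a bound. *)
Lemma egamma_fin_num s : 1 <= s -> egamma s \is a fin_num.
Proof.
move=> s1; rewrite ge0_fin_numE ?egamma_ge0//.
have [k sk] : exists k : nat, s - 1 <= k%:R.
  exists (Num.trunc (s - 1)).+1; apply: ltW; exact: truncnS_gt.
apply: (@le_lt_trans _ _ (egamma 1%:R + egamma k.+1%:R)%E); last first.
  by rewrite !egamma_nat -EFinD ltry.
rewrite /egamma -ge0_integralD//; last 4 first.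
- by move=> t _; rewrite lee_fin mulr_ge0 ?powR_ge0 ?expR_ge0.
- exact: measurable_gamma_integrand.
- by move=> t _; rewrite lee_fin mulr_ge0 ?powR_ge0 ?expR_ge0.
- exact: measurable_gamma_integrand.
apply: ge0_le_integral => //.
- by move=> t _; rewrite lee_fin mulr_ge0 ?powR_ge0 ?expR_ge0.
- exact: measurable_gamma_integrand.
- by apply: emeasurable_funD; exact: measurable_gamma_integrand.
move=> t /=; rewrite in_itv/= andbT => t0.
rewrite -EFinD lee_fin -mulrDl ler_wpM2r ?expR_ge0//.
rewrite subrr powRr0 -natr1 addrK.
have [t1|t1] := leP t 1.
  have : t `^ (s - 1) <= t `^ 0 by apply: ger_powR; rewrite ?t0// subr_ge0.
  by rewrite powRr0 => /le_trans; apply; rewrite lerDl powR_ge0.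
have : t `^ (s - 1) <= t `^ k%:R by apply: ler_powR => //; exact: ltW.
by move=> /le_trans; apply; rewrite lerDr.
Qed.

Lemma continuous_powR_gt0 (s a : R) : 0 < a -> {for a, continuous (@powR R ^~ s)}.
Proof.
move=> a0; apply: differentiable_continuous; apply/derivable1_diffP.
by apply: derivable_powR; rewrite in_itv/= a0.
Qed.

Lemma integral_powR (s t : R) : 1 <= s -> 0 < t ->
  (\int[mu]_(u in `]0%R, t]) (s * u `^ (s - 1))%:E = (t `^ s)%:E)%E.
Proof.
move=> s1 t0; have s0 : 0 < s by apply: lt_le_trans s1.
rewrite integral_itv_obnd_cbnd; last exact: measurable_EFin_powR.
rewrite (@continuous_FTC2 _ _ (@powR R ^~ s)) => //.
- by rewrite powR0 ?gt_eqF// sube0.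
- apply/continuous_within_itvP => //; split.
  + move=> u; rewrite in_itv/= => /andP[u0 _].
    apply: (@continuousM R R (fun=> s) (@powR R ^~ (s - 1))).
      exact: cst_continuous.
    exact: continuous_powR_gt0.
  + apply: cvgM; first exact: cvg_cst.
    (* At s = 1 the integrand is the constant 1, also at 0, where [powR] sends exponent 0 to 1; for
       s > 1 it tends to 0 there. *)
    move: s1; rewrite le_eqVlt => /predU1P[<-|s1].
      rewrite subrr powRr0; under eq_fun do rewrite powRr0; exact: cvg_cst.
    by rewrite powR0 ?subr_eq0 ?gt_eqF//; apply: powR_cvg0; rewrite subr_gt0.
  + apply: cvg_at_left_filter.
    by apply: cvgM; [exact: cvg_cst|exact: continuous_powR_gt0].
- split.
  + by move=> u; rewrite in_itv/= => /andP[u0 _]; apply: derivable_powR; rewrite in_itv/= u0.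
  + by rewrite powR0 ?gt_eqF//; exact: powR_cvg0.
  + by apply: cvg_at_left_filter; exact: continuous_powR_gt0.
- move=> u; rewrite in_itv/= => /andP[u0 _].
  by rewrite powR_derive1// in_itv/= u0.
Qed.

Lemma integral_expN (u : R) : 0 <= u ->
  (\int[mu]_(t in `[u, +oo[) (expR (- t))%:E = (expR (- u))%:E)%E.
Proof.
by move=> u0; rewrite -[RHS](integral_exp_tail 0 u0);
  apply: eq_integral => t _; rewrite expr0 mul1r.
Qed.

(* Both sides are the integral of s u^(s-1) e^(-t) over 0 < u <= t. *)
Lemma egammaS (s : R) : 1 <= s -> egamma (s + 1) = (s%:E * egamma s)%E.
Proof.
move=> s1; have s0 : 0 < s by apply: lt_le_trans s1.
pose F (z : measurableTypeR R * measurableTypeR R) : \bar R :=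
  (if (0 < z.1) && (z.1 <= z.2) then s * z.1 `^ (s - 1) * expR (- z.2) else 0)%:E.
have F0 z : (0 <= F z)%E.
  rewrite /F lee_fin; case: ifPn => // _.
  by rewrite !mulr_ge0 ?powR_ge0 ?expR_ge0// ltW.
have mF : measurable_fun setT F.
  apply/measurable_EFinP; apply: measurable_fun_ifT => //.
  - apply: measurable_and; first exact: measurable_fun_ltr.
    by apply: measurable_fun_ler.
  - apply: measurable_funM.
      apply: measurable_funM => //.
      exact: (measurableT_comp (@measurable_powR R (s - 1)) measurable_fst).
    by apply: measurableT_comp => //; apply: measurableT_comp.
have := fubini_tonelli (m1 := mu) (m2 := mu) F mF F0.
have -> : (\int[mu]_u \int[mu]_t F (u, t) = s%:E * egamma s)%E.
  rewrite /egamma -ge0_integralZl//; last 3 first.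
  - exact: measurable_gamma_integrand.
  - by move=> t _; rewrite lee_fin mulr_ge0 ?powR_ge0 ?expR_ge0.
  - by rewrite lee_fin ltW.
  rewrite [RHS]integral_mkcond; apply: eq_integral => u _; rewrite patchE.
  rewrite mem_setE in_itv/= andbT; case: ifPn => u0; last first.
    by apply: integral0_eq => t _; rewrite /F/= (negbTE u0).
  transitivity (\int[mu]_(t in `[u, +oo[) ((s * u `^ (s - 1))%:E * (expR (- t))%:E))%E.
    rewrite [RHS]integral_mkcond; apply: eq_integral => t _; rewrite patchE.
    by rewrite mem_setE in_itv/= andbT /F/= u0/=; case: ifPn.
  rewrite ge0_integralZl//; last 2 first.
  - apply/measurable_EFinP; apply: measurable_funTS.
    by apply: measurableT_comp => //; exact: measurableT_comp.
  - by rewrite lee_fin mulr_ge0 ?powR_ge0// ltW.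
  by rewrite integral_expN ?(ltW u0)// -!EFinM mulrA.
move=> ->.
rewrite /egamma integral_mkcond; apply: eq_integral => t _; rewrite patchE.
rewrite mem_setE in_itv/= andbT addrK; case: ifPn => t0; last first.
  apply/esym; apply: integral0_eq => u _; rewrite /F/=; case: ifPn => // /andP[u0 ut].
  by rewrite (lt_le_trans u0 ut) in t0.
transitivity (\int[mu]_(u in `]0%R, t]) ((s * u `^ (s - 1))%:E * (expR (- t))%:E))%E.
  rewrite ge0_integralZr//; last 2 first.
  - exact: measurable_EFin_powR.
  - by move=> u _; rewrite lee_fin mulr_ge0 ?powR_ge0// ltW.
  by rewrite integral_powR.
rewrite integral_mkcond; apply: eq_integral => u _; rewrite patchE.
by rewrite mem_setE in_itv/= /F/=; case: ifPn.
Qed.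

Lemma GammaS (s : R) : 1 <= s -> Gamma (s + 1) = s * Gamma s.
Proof.
by move=> s1; rewrite !GammaE egammaS// fineM// egamma_fin_num.
Qed.

End gamma_function.

(** * Polar integration *)

Section radial_moments.
Variable R : realType.
Local Notation mu := (@lebesgue_measure R).

Lemma radial_extZ m r (g : 'rV[R]_m.+1 -> R) x : 0 < r ->
  radial_ext g (r *: x) = radial_ext g x.
Proof.
move=> r0; rewrite /radial_ext scaler_eq0 gt_eqF//= norm2Z gtr0_norm// invfM.
by rewrite scalerA mulrAC mulVf ?gt_eqF// mul1r.
Qed.

Lemma sqrtX_powR (t : R) n : 0 <= t -> Num.sqrt t ^+ n = t `^ (n%:R / 2).
Proof.
move=> t0; rewrite -powR_mulrn ?sqrtr_ge0// -powR12_sqrt// -powRrM.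
by congr (_ `^ _); rewrite mulrC.
Qed.

Lemma iint_ball_ext m t (g : 'rV[R]_m.+1 -> R) : 0 < t -> sbounded g ->
  iint (ball_ext t g) = t `^ (m.+1%:R / 2) * iint (ball_ext 1 g).
Proof.
move=> t0 bg; have r0 : 0 < Num.sqrt t by rewrite sqrtr_gt0.
rewrite (_ : ball_ext 1 g = fun x => ball_ext t g (Num.sqrt t *: x)).
  rewrite iint_scale//; last exact: sbounded_gdom.
  by rewrite -sqrtX_powR ?(ltW t0)// mulrA divff ?mul1r// expf_neq0// gt_eqF.
apply/funext => x; rewrite /ball_ext radial_extZ// innerZl innerZr mulrA -expr2.
rewrite sqr_sqrtr ?(ltW t0)//.
by have -> : (t * inner x x <= t) = (inner x x <= 1) by rewrite -{2}[t]mulr1 ler_pM2l.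
Qed.

Lemma radial_ext_ge0 m (g : 'rV[R]_m.+1 -> R) x :
  (forall x, sphere m x -> 0 <= g x) -> 0 <= radial_ext g x.
Proof.
by move=> g0; rewrite /radial_ext; case: ifPn => // x0; exact/g0/sphere_normalize.
Qed.

(* Tonelli for the integrand [radial_ext g x * w t] on |x|^2 <= t: integrating
   in t first gives the left-hand side, and the scaling of balls the right. *)
Lemma layer_cake m (g : 'rV[R]_m.+1 -> R) (w W : R -> R) :
  sbounded g -> (forall x, sphere m x -> 0 <= g x) ->
  measurable_fun [set: measurableTypeR R] w -> (forall t, 0 < t -> 0 <= w t) ->
  (forall u : R, 0 < u ->
    (\int[mu]_(t in `[u, +oo[) (w t)%:E = (W u)%:E)%E) ->
  (\int[rn_measure R m.+1]_x
     (radial_ext g (rn_row x) * W (inner (rn_row x) (rn_row x)))%:E =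
   (iint (ball_ext 1 g))%:E *
   \int[mu]_(t in `]0%R, +oo[) (w t * t `^ (m.+1%:R / 2))%:E)%E.
Proof.
move=> bg g0 mw w0 wW.
pose F (z : rn R m.+1 * measurableTypeR R) : \bar R :=
  (if inner (rn_row z.1) (rn_row z.1) <= z.2
   then radial_ext g (rn_row z.1) * w z.2 else 0)%:E.
have r0 := radial_ext_ge0 _ g0.
have sq0 (x : 'rV[R]_m.+1) : x != 0 -> 0 < inner x x.
  by move=> x0; rewrite lt_def inner_eq0 x0 inner_ge0.
have F0 z : (0 <= F z)%E.
  rewrite /F lee_fin; case: ifPn => // zt; have [x0|x0] := eqVneq (rn_row z.1) 0.
    by rewrite x0 /radial_ext eqxx mul0r.
  by rewrite mulr_ge0// w0// (lt_le_trans (sq0 _ x0)).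
have mF : measurable_fun setT F.
  apply/measurable_EFinP; apply: measurable_fun_ifT.
  - apply: measurable_fun_ler; last exact: measurable_snd.
    exact: (measurableT_comp (@measurable_sqnorm R m.+1) measurable_fst).
  - apply: measurable_funM.
      exact: (measurableT_comp bg.1 measurable_fst).
    exact: (measurableT_comp mw measurable_snd).
  - exact: measurable_cst.
have := fubini_tonelli (m1 := rn_measure R m.+1) (m2 := mu) F mF F0.
have -> : (\int[rn_measure R m.+1]_x \int[mu]_t F (x, t) =
    \int[rn_measure R m.+1]_x
     (radial_ext g (rn_row x) * W (inner (rn_row x) (rn_row x)))%:E)%E.
  (* At the origin [radial_ext] is 0 by default and both sides vanish; elsewhere |x|^2 > 0, which is
     where [w0] and [wW] apply. *)
  apply: eq_integral => x _; have [x0|x0] := eqVneq (rn_row x) 0.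
    rewrite x0 {1}/radial_ext eqxx mul0r; apply: integral0_eq => t _.
    by rewrite /F/= x0 /radial_ext eqxx mul0r if_same.
  rewrite EFinM -wW ?sq0// -ge0_integralZl//; last 3 first.
  - by apply/measurable_EFinP; exact: measurable_funTS.
  - move=> t /=; rewrite in_itv/= andbT => xt.
    by rewrite lee_fin w0// (lt_le_trans (sq0 _ x0)).
  - by rewrite lee_fin.
  rewrite [RHS]integral_mkcond; apply: eq_integral => t _; rewrite patchE.
  by rewrite mem_setE in_itv/= andbT /F/=; case: ifPn.
move=> ->.
have V0 : 0 <= iint (ball_ext 1 g).
  rewrite iint_integral; last exact: sbounded_gdom.
  by apply: Rintegral_ge0 => x _; rewrite /ball_ext; case: ifPn.
rewrite -ge0_integralZl//; last 2 first.
- apply/measurable_EFinP; apply: measurable_funM; first exact: measurable_funTS.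
  by apply: measurable_funTS; exact: measurable_powR.
- move=> t /=; rewrite in_itv/= andbT => t0.
  by rewrite lee_fin mulr_ge0 ?powR_ge0// w0.
rewrite [RHS]integral_mkcond; apply: eq_integral => t _; rewrite patchE.
rewrite mem_setE in_itv/= andbT; case: ifPn => t0; last first.
  apply: integral0_eq => x _; rewrite /F/=; case: ifPn => // xt.
  have : inner (rn_row x) (rn_row x) == 0 :> R.
    by rewrite eq_le inner_ge0 andbT (le_trans xt)// leNgt.
  by rewrite inner_eq0 => /eqP ->; rewrite /radial_ext eqxx mul0r.
transitivity ((w t)%:E * \int[rn_measure R m.+1]_x (ball_ext t g (rn_row x))%:E)%E.
  rewrite -ge0_integralZl//.
  - apply: eq_integral => x _; rewrite /F/= /ball_ext; case: ifPn => _.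
      by rewrite mulrC EFinM.
    by rewrite mule0.
  - by apply/measurable_EFinP; exact: (sbounded_gdom t bg).1.
  - by move=> x _; rewrite lee_fin /ball_ext; case: ifPn.
  - by rewrite lee_fin w0.
rewrite integral_iint; last exact: sbounded_gdom.
by rewrite iint_ball_ext// -!EFinM; congr EFin; ring.
Qed.

Lemma expr_le_expR (u : R) k : 0 <= u -> u ^+ k <= k`!%:R * expR u.
Proof.
case: k => [|k] u0; first by rewrite expr0 fact0 mul1r leNgt expR_lt1 -leNgt.
rewrite -ler_pdivrMl ?ltr0n ?fact_gt0// mulrC.
by apply: le_trans (expR_ge1Dxn k u0); rewrite lerDr.
Qed.

(** Half of the exponential is spent on (u/2)^k <= k! exp (u/2), which explains the constant. *)
Lemma expr_expN_le (u : R) k : 0 <= u ->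
  u ^+ k * expR (- u) <= 2 ^+ k * k`!%:R * expR (- (u / 2)).
Proof.
move=> u0; have u20 : 0 <= u / 2 by rewrite divr_ge0.
have := expr_le_expR k u20; rewrite expr_div_n ler_pdivrMr ?exprn_gt0// => uk.
rewrite (_ : - (u / 2) = u / 2 - u); last by lra.
rewrite expRD mulrA ler_wpM2r ?expR_ge0// (le_trans uk)//.
by rewrite le_eqVlt; apply/orP; left; apply/eqP; ring.
Qed.

Lemma gdom_radial m (g : 'rV[R]_m.+1 -> R) k : sbounded g ->
  gdom (fun x => radial_ext g x * (inner x x ^+ k * expR (- inner x x))).
Proof.
move=> bg; have [C C0 gC] := sbounded_radial_ext bg; split.
  apply: measurable_funM; first exact: bg.1.
  apply: (@measurableT_comp _ _ _ _ _ _ (fun u : R => u ^+ k * expR (- u))).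
    by apply: continuous_measurable_fun; exact: continuous_pow_expN.
  exact: measurable_sqnorm.
exists (C * (2 ^+ k * k`!%:R)) => x; rewrite normrM -mulrA ler_pM//.
rewrite ger0_norm; last by rewrite mulr_ge0 ?expR_ge0// exprn_ge0// inner_ge0.
by apply: expr_expN_le; exact: inner_ge0.
Qed.

Lemma gdom_exp_tail m (g : 'rV[R]_m.+1 -> R) k : sbounded g ->
  gdom (fun x => radial_ext g x * exp_tail k (inner x x)).
Proof.
move=> bg; elim: k => [|k ih].
  have := gdom_radial 0 bg; congr gdom; apply/funext => x.
  by rewrite expr0 mul1r.
have := gdomD (gdom_radial k.+1 bg) (gdomZ k.+1%:R ih); congr gdom.
by apply/funext => x; rewrite [exp_tail k.+1 _]/=; ring.
Qed.

(** The layer-cake formula needs a nonnegative weight. To obtain u^k exp (-u) directly, the weight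
    would be minus its derivative, which changes sign for k > 0; the tails have the weight t^k exp
    (-t) >= 0 instead. *)
Lemma iint_exp_tail m (g : 'rV[R]_m.+1 -> R) k :
  sbounded g -> (forall x, sphere m x -> 0 <= g x) ->
  iint (fun x => radial_ext g x * exp_tail k (inner x x)) =
  iint (ball_ext 1 g) * Gamma (k%:R + m.+1%:R / 2 + 1).
Proof.
move=> bg g0; have := integral_iint (gdom_exp_tail k bg).
rewrite (@layer_cake _ _ (fun t => t ^+ k * expR (- t)) (exp_tail k))//; last 3 first.
- by apply: continuous_measurable_fun; exact: continuous_pow_expN.
- by move=> t t0; rewrite mulr_ge0 ?expR_ge0// exprn_ge0// ltW.
- by move=> u u0; rewrite integral_exp_tail// ltW.
rewrite (_ : (\int[mu]_(t in _) _)%E = egamma (k%:R + m.+1%:R / 2 + 1)).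
  move=> /(congr1 fine) /= <-; rewrite fineM ?GammaE//.
  by apply: egamma_fin_num; rewrite lerDr addr_ge0// divr_ge0.
apply: eq_integral => t; rewrite inE/= in_itv/= andbT => t0.
rewrite addrK powRD; last by rewrite gt_eqF// implybT.
by rewrite powR_mulrn ?(ltW t0)//; congr EFin; ring.
Qed.

Lemma radial_moment0 m (g : 'rV[R]_m.+1 -> R) :
  sbounded g -> (forall x, sphere m x -> 0 <= g x) ->
  iint (fun x => radial_ext g x * (inner x x ^+ 0 * expR (- inner x x))) =
  iint (ball_ext 1 g) * Gamma (m.+1%:R / 2 + 1).
Proof.
move=> bg g0; have := iint_exp_tail 0 bg g0; rewrite add0r => <-.
by apply: eq_iint => x; rewrite expr0 mul1r.
Qed.

(** The recursion of [exp_tail] isolates u^(k+1) exp (-u) as a combination of two consecutive tails.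
    With d = m + 1 and G = Gamma (k+1+d/2), the functional equation leaves (k+1+d/2) G - (k+1) G =
    (d/2) G. *)
Lemma radial_momentS m (g : 'rV[R]_m.+1 -> R) k :
  sbounded g -> (forall x, sphere m x -> 0 <= g x) ->
  iint (fun x => radial_ext g x * (inner x x ^+ k.+1 * expR (- inner x x))) =
  iint (ball_ext 1 g) * (m.+1%:R / 2 * Gamma (k.+1%:R + m.+1%:R / 2)).
Proof.
move=> bg g0.
have /esym : iint (fun x => radial_ext g x * exp_tail k.+1 (inner x x)) =
  iint (fun x => radial_ext g x * (inner x x ^+ k.+1 * expR (- inner x x))) +
  k.+1%:R * iint (fun x => radial_ext g x * exp_tail k (inner x x)).
  rewrite -iintZ; last exact: gdom_exp_tail.
  rewrite -iintD; last 2 first.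
  - exact: gdom_radial.
  - by apply: gdomZ; exact: gdom_exp_tail.
  by apply: eq_iint => x; rewrite [exp_tail k.+1 _]/=; ring.
rewrite !iint_exp_tail// (@GammaS _ (k.+1%:R + m.+1%:R / 2)); last first.
  by rewrite -natr1 -addrA addrCA lerDl addr_ge0// divr_ge0.
rewrite (_ : k%:R + m.+1%:R / 2 + 1 = k.+1%:R + m.+1%:R / 2); last by rewrite -natr1; ring.
set G := Gamma _; set T := iint _; set V := iint _ => TV.
have -> : T = V * ((k.+1%:R + m.+1%:R / 2) * G) - k.+1%:R * (V * G) by rewrite -TV addrK.
by ring.
Qed.

(** Absorbs the default value of [radial_ext] at the origin. *)
Lemma eq_iint_neq0 n (f g : 'rV[R]_n -> R) : (0 < n)%N -> gdom f -> gdom g ->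
  (forall x, x != 0 -> f x = g x) -> iint f = iint g.
Proof.
move=> n0 df dg fg; apply/eqP; rewrite -subr_eq0 -mulN1r -iintZ//.
have dNg := gdomZ (-1) dg; rewrite -iintD// iint0//; first exact: gdomD.
by move=> x x0; rewrite fg// mulN1r subrr.
Qed.

End radial_moments.

(** * Gaussian and spherical moments *)

Section gaussian_moments.
Variable R : realType.
Local Notation mu := (@lebesgue_measure R).

Definition gmom (j : nat) : R := \int[mu]_t (t ^+ j * gauss_fun t).

Lemma measurable_gmom j :
  measurable_fun [set: measurableTypeR R] (fun t : R => t ^+ j * gauss_fun t).
Proof.
apply: measurable_funM; last exact: measurable_gauss_fun.
exact: exprn_measurable.
Qed.

Lemma integrable_wexp1 :
  mu.-integrable setT (fun t : R => (expR (- (t ^+ 2 / 2)))%:E).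
Proof.
apply/integrableP; split.
  apply/measurable_EFinP; apply: measurableT_comp => //.
  by apply: measurableT_comp => //; apply: measurable_funM => //; exact: exprn_measurable.
apply: le_lt_trans (integral_wexp1 R); rewrite le_eqVlt; apply/orP; left; apply/eqP.
by apply: eq_integral => t _ /=; rewrite ger0_norm ?expR_ge0.
Qed.

Lemma integrable_gmom j :
  mu.-integrable setT (fun t : R => (t ^+ j * gauss_fun t)%:E).
Proof.
apply: (le_integrable measurableT _ _
  (integrableZl measurableT (1 + 2 ^+ j * j`!%:R) integrable_wexp1)).
  by apply/measurable_EFinP; exact: measurable_gmom.
move=> t _; rewrite -EFinM /= lee_fin normrM [X in _ * X <= _]ger0_norm ?gauss_fun_ge0//.
rewrite [leRHS]ger0_norm ?mulr_ge0 ?expR_ge0 ?addr_ge0 ?mulr_ge0//.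
apply: (@le_trans _ _ ((1 + (t ^+ 2) ^+ j) * gauss_fun t)).
  rewrite ler_wpM2r ?gauss_fun_ge0// normrX -exprM mulnC exprM.
  rewrite -(real_normK (num_real (t ^+ j))) normrX.
  set a := `|t| ^+ j; have a0 : 0 <= a by rewrite exprn_ge0.
  have := sqr_ge0 (a - 1); rewrite sqrrB1; nra.
rewrite !mulrDl; apply: lerD.
  rewrite !mul1r /gauss_fun ler_expR.
  have := sqr_ge0 t; lra.
exact: expr_expN_le (sqr_ge0 t).
Qed.

Lemma gmom0 : gmom 0 = Num.sqrt pi.
Proof.
rewrite /gmom; under eq_Rintegral do rewrite expr0 mul1r.
by rewrite /Rintegral integralT_gauss.
Qed.

Lemma gmom_odd k : gmom k.*2.+1 = 0.
Proof.
suff : gmom k.*2.+1 = - gmom k.*2.+1 by move=> h; lra.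
rewrite {1}/gmom -Rintegral_opp; last exact: measurable_gmom.
rewrite -mulN1r /gmom -RintegralZl//; last exact: integrable_gmom.
apply: eq_Rintegral => t _; rewrite /gauss_fun sqrrN.
by rewrite exprNn -signr_odd/= odd_double/= expr1 mulrA.
Qed.

Lemma gdom_sqnorm n k :
  gdom (fun x : 'rV[R]_n => inner x x ^+ k * expR (- inner x x)).
Proof.
split.
  apply: (@measurableT_comp _ _ _ _ _ _ (fun u : R => u ^+ k * expR (- u))).
    by apply: continuous_measurable_fun; exact: continuous_pow_expN.
  exact: measurable_sqnorm.
exists (2 ^+ k * k`!%:R) => x.
rewrite ger0_norm; last by rewrite mulr_ge0 ?expR_ge0// exprn_ge0// inner_ge0.
by apply: expr_expN_le; exact: inner_ge0.
Qed.

Lemma iintS n (g : 'rV[R]_n.+1 -> R) :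
  iint g = \int[mu]_t iint (fun v => g (cons_row t v)).
Proof. by []. Qed.

Lemma inner0 n (x : 'rV[R]_n) : inner (0 : 'rV[R]_n) x = 0.
Proof. by rewrite /inner big1// => i _; rewrite mxE mul0r. Qed.

Lemma gmom_radial k :
  iint (fun x : 'rV[R]_1 => radial_ext (fun=> 1) x *
    (inner x x ^+ k * expR (- inner x x))) = gmom k.*2.
Proof.
rewrite (@eq_iint_neq0 _ _ _ (fun x => inner x x ^+ k * expR (- inner x x)))//; last 3 first.
- by apply: gdom_radial; exact: sbounded_cst.
- exact: gdom_sqnorm.
- by move=> x x0; rewrite /radial_ext x0 mul1r.
rewrite iintS; apply: eq_Rintegral => t _.
by rewrite /iint inner_cons_row inner0 addr0 -expr2 -exprM mul2n.
Qed.

(** The polar formula in dimension one, over the sphere {-1, 1}, gives what integration by parts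
    would: both moments are Gamma factors times the same ball integral. *)
Lemma gmom_even k : gmom k.+1.*2 = (k%:R + 2^-1) * gmom k.*2.
Proof.
have b1 : sbounded (fun _ : 'rV[R]_1 => 1 : R) by exact: sbounded_cst.
rewrite -!gmom_radial radial_momentS//.
(* For k = 0 both moments are expressed by Gamma (3/2), so Gamma (1/2), outside the range of
   [GammaS], never occurs. *)
case: k => [|k].
  rewrite radial_moment0// !mul1r add0r addrC.
  by rewrite mulrCA.
rewrite radial_momentS// (_ : k.+2%:R + 1 / 2 = k.+1%:R + 1 / 2 + 1); last first.
  by rewrite -[k.+2%:R]natr1; ring.
rewrite GammaS.
  by rewrite !mul1r; ring.
by rewrite -[k.+1%:R]natr1 -addrA addrCA lerDl addr_ge0// ?divr_ge0.
Qed.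

Lemma gmom1 : gmom 1 = 0.
Proof. exact: (gmom_odd 0). Qed.

Lemma gmomSS j : gmom j.+2 = j.+1%:R / 2 * gmom j.
Proof.
rewrite -(odd_double_half j); case: (odd j) => /=.
  by rewrite add1n -doubleS !gmom_odd mulr0.
rewrite add0n -doubleS gmom_even; congr (_ * _).
have -> : j./2.*2.+1%:R = 2 * j./2%:R + 1 :> R by rewrite -natr1 -mul2n natrM.
by field.
Qed.

(** * Gaussian moments of affine forms, by Hermite-type polynomials *)

Definition gpoly (q : {poly R}) : R := \int[mu]_t (q.[t] * gauss_fun t).

Lemma integrable_sum_ord n (F : 'I_n -> R -> R) :
  (forall i, mu.-integrable setT (EFin \o F i)) ->
  mu.-integrable setT (EFin \o (fun t => \sum_(i < n) F i t)).
Proof.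
move=> iF; rewrite (_ : EFin \o _ = fun t => \sum_(i < n) (EFin \o F i) t)%E.
  by apply: integrable_sum => // i _; exact: iF.
by apply/funext => t /=; rewrite sumEFin.
Qed.

Lemma Rintegral_sum_ord n (F : 'I_n -> R -> R) :
  (forall i, mu.-integrable setT (EFin \o F i)) ->
  \int[mu]_t (\sum_(i < n) F i t) = \sum_(i < n) \int[mu]_t F i t.
Proof.
elim: n F => [|n ih] F iF.
  by rewrite big_ord0; under eq_Rintegral do rewrite big_ord0; rewrite Rintegral_cst// mul0r.
under eq_Rintegral do rewrite big_ord_recr/=.
rewrite RintegralD//; last by apply: integrable_sum_ord => i; exact: iF.
by rewrite ih ?big_ord_recr// => i; exact: iF.
Qed.

Lemma integrable_gpoly q : mu.-integrable setT (EFin \o (fun t : R => q.[t] * gauss_fun t)).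
Proof.
rewrite (_ : (fun t => _) = fun t => \sum_(i < size q) q`_i * (t ^+ i * gauss_fun t)).
  apply: integrable_sum_ord => i.
  exact: (integrableZl measurableT q`_i (integrable_gmom i)).
apply/funext => t; rewrite horner_coef mulr_suml.
by apply: eq_bigr => i _; rewrite mulrA.
Qed.

Lemma gpolyE N (q : {poly R}) : (size q <= N)%N ->
  gpoly q = \sum_(i < N) q`_i * gmom i.
Proof.
move=> qN; rewrite /gpoly.
under eq_Rintegral.
  move=> t _; rewrite (horner_coef_wide _ qN) mulr_suml.
  under eq_bigr do rewrite -mulrA.
  over.
rewrite Rintegral_sum_ord => [|i].
  by apply: eq_bigr => i _; rewrite RintegralZl//; exact: integrable_gmom.
exact: (integrableZl measurableT q`_i (integrable_gmom i)).
Qed.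

Lemma gpolyD p q : gpoly (p + q) = gpoly p + gpoly q.
Proof.
pose N := maxn (size p) (size q).
rewrite (@gpolyE N) ?(leq_trans (size_polyD _ _))// (@gpolyE N p) ?leq_maxl//.
rewrite (@gpolyE N q) ?leq_maxr// -big_split; apply: eq_bigr => i _ /=.
by rewrite coefD mulrDl.
Qed.

Lemma gpolyZ c q : gpoly (c *: q) = c * gpoly q.
Proof.
rewrite (@gpolyE (size q)) ?size_scale_leq// (@gpolyE (size q) q)//.
by rewrite mulr_sumr; apply: eq_bigr => i _; rewrite coefZ mulrA.
Qed.

(* Integration by parts against the Gaussian, read off the moments. *)
Lemma gpolyXM q : gpoly ('X * q) = 2^-1 * gpoly q^`().
Proof.
pose N := size q.
rewrite (@gpolyE N.+2); last first.
  by rewrite (leq_trans (size_polyMleq _ _))// size_polyX ltnW.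
rewrite (@gpolyE N q^`()); last first.
  by apply/leq_sizeP => j Nj; rewrite coef_deriv nth_default ?mul0rn// leqW.
rewrite !big_ord_recl /= coefXM mul0r add0r coefXM/= gmom1 mulr0 add0r.
rewrite mulr_sumr; apply: eq_bigr => i _.
by rewrite coefXM/= coef_deriv /bump/= !add1n gmomSS -[_ *+ _]mulr_natr; ring.
Qed.

(* [hpoly q j].[a] is E (a + Z)^j for a centred Gaussian Z of variance q / 2. *)
Fixpoint hpoly (q : R) (j : nat) : {poly R} :=
  match j with
  | 0 => 1
  | 1 => 'X
  | (j'.+1 as j1).+1 => 'X * hpoly q j1 + (q / 2 * j1%:R) *: hpoly q j'
  end.

Lemma hpolySS q j :
  hpoly q j.+2 = 'X * hpoly q j.+1 + (q / 2 * j.+1%:R) *: hpoly q j.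
Proof. by []. Qed.

(** As translates of monomials averaged over a Gaussian, these polynomials differentiate like
    monomials. The recursion has depth two, so the induction carries two consecutive degrees. *)
Lemma deriv_hpoly q j : (hpoly q j.+1)^`() = j.+1%:R *: hpoly q j.
Proof.
suff : (hpoly q j.+1)^`() = j.+1%:R *: hpoly q j /\
       (hpoly q j.+2)^`() = j.+2%:R *: hpoly q j.+1 by case.
elim: j => [|j [ih1 ih2]]; split => //.
- by rewrite derivX scale1r.
- rewrite hpolySS derivD derivM derivX derivZ -polyC1 derivC scaler0 addr0.
  by rewrite mul1r mulr1 -mulr2n scaler_nat.
rewrite hpolySS derivD derivM derivX derivZ ih2 ih1 mul1r.
rewrite -[j.+3%:R]natr1 (scalerDl (hpoly q j.+2) j.+2%:R 1) scale1r [RHS]addrC -addrA; congr (_ + _).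
rewrite hpolySS scalerDr -scalerAr !scalerA; congr (_ + _ *: _); ring.
Qed.

Lemma gpoly_affineM a b (A : {poly R}) :
  gpoly ((b *: 'X + a%:P) * A) = b / 2 * gpoly A^`() + a * gpoly A.
Proof.
rewrite mulrDl -scalerAl mul_polyC gpolyD !gpolyZ gpolyXM; ring.
Qed.

Lemma gpoly1 : gpoly 1 = Num.sqrt pi.
Proof. by rewrite (@gpolyE 1) ?size_poly1// big_ord1 coef1 mul1r gmom0. Qed.

(** Variances of independent Gaussians add: under the density exp (-t^2) / sqrt pi, the variable b t
    has variance b^2 / 2. Formally, integration by parts and [deriv_hpoly] turn the recursion for
    [q] into the one for [q + b ^+ 2]. *)
Lemma hpoly_gauss q a b j :
  gpoly (hpoly q j \Po (b *: 'X + a%:P)) =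
  Num.sqrt pi * (hpoly (q + b ^+ 2) j).[a].
Proof.
suff : gpoly (hpoly q j \Po (b *: 'X + a%:P)) =
    Num.sqrt pi * (hpoly (q + b ^+ 2) j).[a] /\
  gpoly (hpoly q j.+1 \Po (b *: 'X + a%:P)) =
    Num.sqrt pi * (hpoly (q + b ^+ 2) j.+1).[a] by case.
elim: j => [|j [ih1 ih2]]; split => //.
- by rewrite [hpoly _ 0]/= [hpoly _ 0]/= -polyC1 comp_polyC polyC1 gpoly1 -polyC1 hornerC mulr1.
- rewrite [hpoly _ 1]/= [hpoly _ 1]/= comp_polyX hornerX -[X in gpoly X]mulr1 gpoly_affineM -polyC1 derivC.
  by rewrite polyC1 gpoly1 -(scale0r 1) gpolyZ; ring.
rewrite !hpolySS comp_polyD comp_polyM comp_polyX comp_polyZ gpolyD gpolyZ.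
rewrite gpoly_affineM deriv_comp deriv_hpoly comp_polyZ.
rewrite derivD derivZ derivX derivC addr0 mulr_algr !gpolyZ.
rewrite ih1 ih2 hornerD hornerM hornerX hornerZ; ring.
Qed.

Lemma hpoly0 j : hpoly 0 j = 'X^j.
Proof.
suff : hpoly 0 j = 'X^j /\ hpoly 0 j.+1 = 'X^(j.+1) by case.
elim: j => [|j [ih1 ih2]]; split => //.
by rewrite hpolySS ih2 !mul0r scale0r addr0 -exprS.
Qed.

(** Even moments of a centred Gaussian of variance 1/2, written so that (2k)! will cancel against
    the exponential series and leave the k! of the Bessel series. *)
Lemma hpoly_even k : (hpoly 1 k.*2).[0] = (k.*2)`!%:R / (4 ^+ k * k`!%:R).
Proof.
elim: k => [|k ih]; first by rewrite hornerC fact0 expr0 mul1r divr1.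
rewrite doubleS hpolySS hornerD hornerM hornerX mul0r add0r hornerZ ih.
have f0 (n : nat) : n`!%:R != 0 :> R by rewrite pnatr_eq0 -lt0n fact_gt0.
rewrite !factS !natrM exprS.
have -> : k.*2.+2%:R = 2 * k.+1%:R :> R by rewrite -natrM mul2n doubleS.
have a0 : k.+1%:R != 0 :> R by rewrite pnatr_eq0.
have d0 : (4 : R) ^+ k != 0 by rewrite expf_neq0// pnatr_eq0.
have := f0 k; move: (k.+1%:R) (k.*2.+1%:R) (k.*2)`!%:R (4 ^+ k) k`!%:R a0 d0.
by move=> u v w y z u0 y0 z0; field; rewrite ?u0 ?y0 ?z0.
Qed.

Lemma gdom_inner_gauss n (c : 'rV[R]_n) a j :
  gdom (fun x => (a + inner x c) ^+ j * expR (- inner x x)).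
Proof.
split.
  apply: measurable_funM.
    apply: (@measurableT_comp _ _ _ _ _ _ (fun u : R => u ^+ j)).
      exact: exprn_measurable.
    by apply: measurable_funD => //; exact: measurable_inner.
  apply: measurableT_comp => //; apply: measurableT_comp => //.
  exact: measurable_sqnorm.
(* From |x_i c_i| <= x_i^2 + c_i^2 the base is at most K + |x|^2 in absolute value. Then
   [expr_expN_le] is applied at K + |x|^2, at the price of a factor exp K. *)
pose K := `|a| + inner c c; have K0 : 0 <= K by rewrite addr_ge0// inner_ge0.
exists (expR K * (2 ^+ j * j`!%:R)) => x.
have ac : `|a + inner x c| <= K + inner x x.
  rewrite (le_trans (ler_normD _ _))// -addrA lerD2l.
  rewrite (le_trans (ler_norm_sum _ _ _))// /inner -big_split/=.
  apply: ler_sum => i _; rewrite normrM.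
  rewrite -[c 0 i * c 0 i]expr2 -[x 0 i * x 0 i]expr2.
  rewrite -(real_normK (num_real (x 0 i))) -(real_normK (num_real (c 0 i))).
  have := sqr_ge0 (`|x 0 i| - `|c 0 i|); have := sqr_ge0 (`|x 0 i|).
  have := sqr_ge0 (`|c 0 i|); nra.
have u0 := inner_ge0 x; set u := inner x x in ac u0 *.
rewrite normrM normrX [X in _ * X]ger0_norm ?expR_ge0//.
apply: (@le_trans _ _ ((K + u) ^+ j * expR (- u))).
  rewrite ler_wpM2r ?expR_ge0//; apply: lerXn2r => //; rewrite nnegrE//.
  exact: addr_ge0.
have := expr_expN_le j (addr_ge0 K0 u0).
rewrite opprD expRD mulrCA -ler_pdivlMl ?expR_gt0// -expRN opprK => /le_trans; apply.
rewrite -[leRHS]mulrA ler_wpM2l ?expR_ge0// ler_wpM2l ?mulr_ge0 ?exprn_ge0//.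
by rewrite /wexp ler_expR -/u; lra.
Qed.

(** The shift [a] makes the induction go through: with the first coordinate frozen at t, the term
    c_0 t joins it, and integrating over t then adds c_0^2 to the variance parameter. The result
    depends on [c] through |c|^2 alone. *)
Lemma iint_inner_gauss n (c : 'rV[R]_n) a j :
  iint (fun x => (a + inner x c) ^+ j * expR (- inner x x)) =
  Num.sqrt pi ^+ n * (hpoly (inner c c) j).[a].
Proof.
elim: n c a j => [|n ih] c a j.
  rewrite /iint !inner0 addr0 oppr0 expR0 mulr1 expr0 mul1r.
  by rewrite /inner big_ord0 hpoly0 hornerXn.
rewrite [c]rowK_cons; set c0 := c 0 0; set c' := \row_i _.
rewrite iintS inner_cons_row -expr2 [c0 ^+ 2 + _]addrC exprSr -mulrA -hpoly_gauss.
rewrite /gpoly -RintegralZl//; last exact: integrable_gpoly.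
apply: eq_Rintegral => t _.
have -> : (fun v => (a + inner (cons_row t v) (cons_row c0 c')) ^+ j *
    expR (- inner (cons_row t v) (cons_row t v))) =
  fun v => gauss_fun t * ((c0 * t + a + inner v c') ^+ j * expR (- inner v v)).
  apply/funext => v; rewrite !inner_cons_row opprD expRD /gauss_fun -expr2.
  by rewrite mulrCA; congr (_ * (_ ^+ _ * _)); ring.
rewrite iintZ; last exact: gdom_inner_gauss.
by rewrite ih horner_comp hornerD hornerZ hornerX hornerC mulrCA [_ * gauss_fun _]mulrC.
Qed.

Lemma radial_ext_innerX m (c : 'rV[R]_m.+1) k x : x != 0 ->
  radial_ext (fun y => inner y c ^+ k.*2) x * inner x x ^+ k = inner x c ^+ k.*2.
Proof.
move=> x0; rewrite /radial_ext x0 innerZl -sqr_norm2 -exprM mul2n -exprMn mulrAC.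
by rewrite mulVf ?mul1r// norm2_eq0.
Qed.

Lemma sphere_moment_even m (c : 'rV[R]_m.+1) k : (0 < m)%N -> sphere m c ->
  sphere_integral (fun x => inner x c ^+ k.*2) * Gamma (k%:R + m.+1%:R / 2) =
  2 * Num.sqrt pi ^+ m.+1 * ((k.*2)`!%:R / (4 ^+ k * k`!%:R)).
Proof.
move=> m0 /sphereE cS; pose g (x : 'rV[R]_m.+1) := inner x c ^+ k.*2.
have bg : sbounded g by apply: sboundedX; exact: sbounded_inner.
have g0 x : sphere m x -> 0 <= g x.
  by move=> _; rewrite /g -mul2n exprM exprn_ge0// sqr_ge0.
have : iint (fun x => radial_ext g x * (inner x x ^+ k * expR (- inner x x))) =
    iint (ball_ext 1 g) * (m.+1%:R / 2 * Gamma (k%:R + m.+1%:R / 2)).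
  (* For k = 0 the polar formula contains Gamma (d/2 + 1) with d = m + 1; lowering its argument asks
     for d/2 >= 1, that is m >= 1. *)
  case: k @g bg g0 => [|k] g bg g0; last by rewrite radial_momentS.
  rewrite radial_moment0// add0r GammaS//.
  by rewrite ler_pdivlMr// mul1r ler_nat.
rewrite (@eq_iint_neq0 _ _ _ (fun x => (0 + inner x c) ^+ k.*2 * expR (- inner x x)))//; last 3 first.
- exact: gdom_radial.
- exact: gdom_inner_gauss.
- by move=> x x0; rewrite add0r mulrA radial_ext_innerX.
rewrite iint_inner_gauss cS hpoly_even sphere_integralE => h.
by rewrite -[RHS]mulrA h -/g; field.
Qed.

Lemma sphere_moment_odd m (c : 'rV[R]_m.+1) k :
  sphere_integral (fun x => inner x c ^+ k.*2.+1) = 0.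
Proof.
pose g (x : 'rV[R]_m.+1) := inner x c ^+ k.*2.+1.
have bg : sbounded g by apply: sboundedX; exact: sbounded_inner.
suff : iint (ball_ext 1 g) = - iint (ball_ext 1 g).
  by move=> h; rewrite sphere_integralE (_ : iint _ = 0) ?mulr0//; rewrite -/g; lra.
rewrite -{1}iint_opp; last exact: sbounded_gdom.
rewrite -mulN1r -iintZ; last exact: sbounded_gdom.
apply: eq_iint => x; rewrite /ball_ext /radial_ext oppr_eq0 -scaleN1r innerZl innerZr.
rewrite mulrA mulrNN !mul1r norm2Z normrN1 mul1r; case: ifPn => _; last by rewrite mulr0.
case: ifPn => _; last by rewrite mulr0.
rewrite /g scalerA mulrN1 scaleNr -scaleN1r innerZl exprMn.
by rewrite -signr_odd/= odd_double expr1.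
Qed.

End gaussian_moments.

(** * The normalizing constant *)

Section normalizing_constant.
Variable R : realType.
Local Notation mu := (@lebesgue_measure R).

Definition exp_sum (N : nat) (u : R) : R := \sum_(j < N) j`!%:R^-1 * u ^+ j.

Lemma cvg_exp_sum (u : R) : exp_sum N u @[N --> \oo] --> expR u.
Proof.
have -> : (fun N => exp_sum N u) = series (exp_coeff u).
  apply/funext => N; rewrite /series/= big_mkord; apply: eq_bigr => j _.
  by rewrite /exp_coeff/= mulrC.
exact: is_cvg_series_exp_coeff.
Qed.

Lemma exp_sum_diff_le (u k : R) N M : (N <= M)%N -> `|u| <= k ->
  `|exp_sum M u - exp_sum N u| <= exp_sum M k - exp_sum N k.
Proof.
move=> NM uk; have k0 : 0 <= k by rewrite (le_trans _ uk).
rewrite /exp_sum -!(big_mkord xpredT (fun j => j`!%:R^-1 * _ ^+ j)).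
rewrite !(big_cat_nat (leq0n N) NM)//= !(addrC (\sum_(0 <= i < N) _)) !addrK.
rewrite (le_trans (ler_norm_sum _ _ _))//; apply: ler_sum => j _.
rewrite normrM ger0_norm ?invr_ge0// ler_wpM2l ?invr_ge0// normrX.
by apply: lerXn2r => //; rewrite nnegrE.
Qed.

Lemma exp_sum_le_expR (k : R) N : 0 <= k -> exp_sum N k <= expR k.
Proof.
move=> k0; rewrite -(cvg_lim (@Rhausdorff R) (@cvg_exp_sum k)).
apply: nondecreasing_cvgn_le; last by apply/cvg_ex; exists (expR k); exact: cvg_exp_sum.
move=> a b ab; rewrite /exp_sum -!(big_mkord xpredT (fun j => j`!%:R^-1 * _ ^+ j)).
rewrite [leRHS](big_cat_nat (leq0n a) ab)//= lerDl; apply: sumr_ge0 => j _.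
by rewrite mulr_ge0 ?invr_ge0// exprn_ge0.
Qed.

(** Remainders are dominated term by term by those at [k]. The bound is uniform in [u], so the
    series and the surface integral can be exchanged by monotonicity alone. *)
Lemma expR_sub_exp_sum_le (u k : R) N : `|u| <= k ->
  `|expR u - exp_sum N u| <= expR k - exp_sum N k.
Proof.
move=> uk; have k0 : 0 <= k by rewrite (le_trans _ uk).
have cv : `|exp_sum M u - exp_sum N u| @[M --> \oo] --> `|expR u - exp_sum N u|.
  apply: cvg_norm; apply: cvgB; last exact: cvg_cst.
  exact: cvg_exp_sum.
rewrite -(cvg_lim (@Rhausdorff R) cv).
apply: limr_le; first by apply/cvg_ex; eexists; exact: cv.
exists N => // M /= NM; rewrite (le_trans (exp_sum_diff_le NM uk))//.
by rewrite lerD2r exp_sum_le_expR.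
Qed.

Lemma sbounded_sum m n (F : 'I_n -> 'rV[R]_m.+1 -> R) :
  (forall i, sbounded (F i)) -> sbounded (fun x => \sum_(i < n) F i x).
Proof.
elim: n F => [|n ih] F bF.
  by under eq_fun do rewrite big_ord0; exact: sbounded_cst.
under eq_fun do rewrite big_ord_recr/=; apply: sboundedD => //.
by apply: ih => i; exact: bF.
Qed.

Lemma sphere_integral_sum m n (F : 'I_n -> 'rV[R]_m.+1 -> R) :
  (forall i, sbounded (F i)) ->
  sphere_integral (fun x => \sum_(i < n) F i x) = \sum_(i < n) sphere_integral (F i).
Proof.
elim: n F => [|n ih] F bF.
  under eq_fun do rewrite big_ord0; rewrite big_ord0.
  by under eq_fun do rewrite -(mulr0 0); rewrite sphere_integralZ ?mul0r//; exact: sbounded_cst.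
under eq_fun do rewrite big_ord_recr/=; rewrite sphere_integralD//; last first.
  by apply: sbounded_sum => i; exact: bF.
by rewrite ih ?big_ord_recr// => i; exact: bF.
Qed.

Lemma sphere_integralB m (f g : 'rV[R]_m.+1 -> R) : sbounded f -> sbounded g ->
  sphere_integral (fun x => f x - g x) = sphere_integral f - sphere_integral g.
Proof.
move=> bf bg; under eq_fun do rewrite -[- g _]mulN1r.
rewrite sphere_integralD//; last exact: sboundedZ.
by rewrite sphere_integralZ// mulN1r.
Qed.

Lemma ler_norm_sphere_integral m (f g : 'rV[R]_m.+1 -> R) :
  sbounded f -> sbounded g ->
  (forall x, sphere m x -> `|f x| <= g x) ->
  `|sphere_integral f| <= sphere_integral g.
Proof.
move=> bf bg fg; rewrite ler_norml; apply/andP; split.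
  rewrite -mulN1r -sphere_integralZ//; apply: le_sphere_integral => //.
    exact: sboundedZ.
  by move=> x /fg; rewrite ler_norml mulN1r => /andP[].
by apply: le_sphere_integral => // x /fg; rewrite ler_norml => /andP[].
Qed.

Definition vmf_mass m (kappa : R) (c : 'rV[R]_m.+1) : R :=
  sphere_integral (fun x => expR (kappa * inner x c)).

Lemma sbounded_vmf m (kappa : R) (c : 'rV[R]_m.+1) :
  sbounded (fun x => expR (kappa * inner x c)).
Proof. by apply: sbounded_expR; apply: sboundedZ; exact: sbounded_inner. Qed.

Lemma cvg_vmf_mass m (kappa : R) (c : 'rV[R]_m.+1) : 0 <= kappa -> sphere m c ->
  \sum_(j < N) j`!%:R^-1 * kappa ^+ j * sphere_integral (fun x => inner x c ^+ j)
    @[N --> \oo] --> vmf_mass kappa c.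
Proof.
move=> k0 cS; have bi j : sbounded (fun x => inner x c ^+ j).
  by apply: sboundedX; exact: sbounded_inner.
have SE N : \sum_(j < N) j`!%:R^-1 * kappa ^+ j *
    sphere_integral (fun x => inner x c ^+ j) =
    sphere_integral (fun x => exp_sum N (kappa * inner x c)).
  rewrite sphere_integral_sum; last by move=> i; under eq_fun do rewrite exprMn; do 2 apply: sboundedZ.
  apply: eq_bigr => j _; rewrite -sphere_integralZ//; apply: eq_sphere_integral => x _.
  by rewrite exprMn mulrA.
have bS N : sbounded (fun x => exp_sum N (kappa * inner x c)).
  by apply: sbounded_sum => j; apply: sboundedZ; apply: sboundedX; apply: sboundedZ; exact: sbounded_inner.
have le1 N : `|vmf_mass kappa c - \sum_(j < N) j`!%:R^-1 * kappa ^+ j *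
    sphere_integral (fun x => inner x c ^+ j)| <=
    (expR kappa - exp_sum N kappa) * sphere_integral (fun _ : 'rV[R]_m.+1 => 1).
  rewrite SE -sphere_integralB//; last exact: sbounded_vmf.
  rewrite -sphere_integralZ; last exact: sbounded_cst.
  apply: ler_norm_sphere_integral.
  - under eq_fun do rewrite -mulN1r; apply: sboundedD; first exact: sbounded_vmf.
    exact: sboundedZ.
  - by apply: sboundedZ; exact: sbounded_cst.
  move=> x xS; rewrite mulr1; apply: expR_sub_exp_sum_le.
  by rewrite normrM ger0_norm// ler_piMr// inner_sphere.
apply/cvgrPdist_le => e e0.
have cv : (expR kappa - exp_sum N kappa) * sphere_integral (fun _ : 'rV[R]_m.+1 => 1)
    @[N --> \oo] --> (0 : R).
  rewrite -(mul0r (sphere_integral (fun _ : 'rV[R]_m.+1 => 1))) -(subrr (expR kappa)).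
  apply: cvgM; last exact: cvg_cst.
  by apply: cvgB; [exact: cvg_cst|exact: cvg_exp_sum].
move/cvgrPdist_le : cv => /(_ e e0); apply: filterS => N.
rewrite sub0r normrN => h; rewrite (le_trans (le1 N))// (le_trans (ler_norm _))//.
Qed.

Lemma sum_ord_double n (F : nat -> R) : (forall k, F k.*2.+1 = 0) ->
  \sum_(j < n.*2) F j = \sum_(k < n) F k.*2.
Proof.
move=> F0; elim: n => [|n ih]; first by rewrite !big_ord0.
by rewrite doubleS !big_ord_recr/= F0 addr0 ih.
Qed.

Lemma besselI_term m (kappa : R) (c : 'rV[R]_m.+1) k : (0 < m)%N ->
  0 < kappa -> sphere m c ->
  (kappa / 2) `^ (2 * k%:R + (m.+1%:R / 2 - 1)) /
    (k`!%:R * Gamma (k%:R + (m.+1%:R / 2 - 1) + 1)) =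
  (kappa / 2) `^ (m.+1%:R / 2 - 1) / (2 * Num.sqrt pi ^+ m.+1) *
  ((k.*2)`!%:R^-1 * kappa ^+ k.*2 * sphere_integral (fun x => inner x c ^+ k.*2)).
Proof.
move=> m0 k0 cS; rewrite (_ : k%:R + (m.+1%:R / 2 - 1) + 1 = k%:R + m.+1%:R / 2); last by ring.
have := sphere_moment_even k m0 cS; set M := sphere_integral _; set G := Gamma _ => MG.
have f0 (n : nat) : n`!%:R != 0 :> R by rewrite pnatr_eq0 -lt0n fact_gt0.
have p0 : Num.sqrt pi ^+ m.+1 != 0 :> R.
  by rewrite expf_neq0// gt_eqF// sqrtr_gt0 pi_gt0.
have q0 : (4 : R) ^+ k != 0 by rewrite expf_neq0// pnatr_eq0.
(* Nonvanishing of [G] is read off [MG], whose right-hand side is nonzero. *)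
have G0 : G != 0.
  apply/eqP => G0; move: MG; rewrite G0 mulr0 => /esym/eqP.
  by rewrite !(mulf_eq0, invr_eq0) (negbTE p0) (negbTE q0) !(negbTE (f0 _)) pnatr_eq0.
have k20 : 0 < kappa / 2 by rewrite divr_gt0.
rewrite powRD ?(gt_eqF k20) ?implybT// (_ : 2 * k%:R = k.*2%:R); last first.
  by rewrite -natrM mul2n.
rewrite powR_mulrn ?(ltW k20)//; set P := (kappa / 2) `^ _.
have -> : M = 2 * Num.sqrt pi ^+ m.+1 * ((k.*2)`!%:R / (4 ^+ k * k`!%:R)) / G.
  by rewrite -MG mulfK.
rewrite expr_div_n (_ : 2 ^+ k.*2 = 4 ^+ k :> R); last first.
  by rewrite -mul2n exprM -natrX.
have := f0 k; have := f0 k.*2; move: p0 q0 G0.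
move: (Num.sqrt _ ^+ _) (4 ^+ k) G {MG} (k`!%:R) ((k.*2)`!%:R) (kappa ^+ _) P.
by move=> a b g d e h i a0 b0 g0 d0 e0; field; rewrite ?a0 ?b0 ?g0 ?d0 ?e0.
Qed.

Lemma vmf_constE m (kappa : R) (c : 'rV[R]_m.+1) : (0 < m)%N ->
  0 < kappa -> sphere m c -> vmf_const m kappa = (vmf_mass kappa c)^-1.
Proof.
move=> m0 k0 cS; pose v : R := m.+1%:R / 2 - 1.
pose C := (kappa / 2) `^ v / (2 * Num.sqrt pi ^+ m.+1).
have bE : besselI v kappa = C * vmf_mass kappa c.
  apply: (cvg_lim (@Rhausdorff R)).
  (* N Bessel terms correspond to 2N terms of the expanded exponential, of which the odd ones
     vanish; the limit is then taken along a subsequence. *)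
  have -> : (fun N => \sum_(0 <= k < N) (kappa / 2) `^ (2 * k%:R + v) /
      (k`!%:R * Gamma (k%:R + v + 1))) =
    fun N => C * \sum_(j < N.*2) j`!%:R^-1 * kappa ^+ j *
      sphere_integral (fun x => inner x c ^+ j).
    apply/funext => N; rewrite big_mkord (@sum_ord_double N
      (fun j => j`!%:R^-1 * kappa ^+ j * sphere_integral (fun x => inner x c ^+ j))).
      by rewrite mulr_sumr; apply: eq_bigr => k _; exact: besselI_term.
    by move=> k; rewrite sphere_moment_odd mulr0.
  apply: cvgM; first exact: cvg_cst.
  move=> A /(cvg_vmf_mass (ltW k0) cS) [N _ NA]; exists N => // n /= Nn.
  apply: (NA n.*2) => /=.
  by rewrite (leq_trans Nn)// -addnn leq_addr.
rewrite /vmf_const -/v bE /C.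
have s0 : 0 < Num.sqrt (pi : R) by rewrite sqrtr_gt0 pi_gt0.
(* Since (m+1)/2 = v + 1, one factor 2 splits off and cancels the one in [C]. *)
have -> : (2 * pi) `^ (m.+1%:R / 2) = 2 * 2 `^ v * Num.sqrt pi ^+ m.+1.
  rewrite powRM ?pi_ge0// sqrtX_powR ?pi_ge0//; congr (_ * _).
  by rewrite mulr_powRB1// divr_gt0.
have k2 : (kappa / 2) `^ v * 2 `^ v = kappa `^ v.
  by rewrite -powRM ?divr_ge0 ?(ltW k0)// divfK// pnatr_eq0.
rewrite -k2.
have h1 : (kappa / 2) `^ v != 0 by rewrite gt_eqF// powR_gt0// divr_gt0.
have h2 : (2 : R) `^ v != 0 by rewrite gt_eqF// powR_gt0.
have h3 : Num.sqrt (pi : R) ^+ m.+1 != 0 by rewrite expf_neq0// gt_eqF.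
move: (vmf_mass kappa c) {bE} => A; rewrite !invfM !invrK.
move: h1 h2 h3; move: (_ `^ v) (_ `^ v) (Num.sqrt _ ^+ _) A^-1.
by move=> a b d e a0 b0 d0; field; rewrite ?a0 ?b0 ?d0.
Qed.

End normalizing_constant.

(** * Concentration *)

Section lower_bound.
Variable R : realType.
Local Notation mu := (@lebesgue_measure R).

(** The indicator of a sup-norm ball as a product over coordinates, a form that [iint] integrates
    factor by factor. *)
Definition box n (c : 'rV[R]_n) (r : R) (x : 'rV[R]_n) : R :=
  \prod_(i < n) (`|c 0 i - x 0 i| < r)%R%:R.

Lemma box_ge0 n (c : 'rV[R]_n) r x : 0 <= box c r x.
Proof. by apply: prodr_ge0 => i _; rewrite ler0n. Qed.

Lemma box_le1 n (c : 'rV[R]_n) r x : box c r x <= 1.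
Proof. by apply: prodr_ile1 => i _; rewrite ler0n lern1 leq_b1. Qed.

Lemma box_ball n (c : 'rV[R]_n) r x : 0 < r -> box c r x != 0 -> ball c r x.
Proof.
move=> r0 /prodf_neq0 h; split=> // i j; rewrite ord1 /ball/=.
by have := h j isT; case: (_ < r) => //; rewrite eqxx.
Qed.

Lemma gdom_box n (c : 'rV[R]_n) r : 0 < r -> gdom (box c r).
Proof.
move=> r0; split.
  apply: measurable_prod => i _.
  rewrite (_ : (fun x => _) = fun x : rn R n =>
    if `|c 0 i - rn_row x 0 i| < r then 1 else 0 : R); last first.
    by apply/funext => x; case: (_ < r).
  apply: measurable_fun_ifT => //.
  apply: measurable_fun_ltr => //; apply: measurableT_comp => //.
  by apply: measurable_funB => //; exact: measurable_rn_coord.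
pose K := \sum_(i < n) (`|c 0 i| + r) ^+ 2.
exists (expR (K / 2)) => x; rewrite ger0_norm ?box_ge0//.
have [->|b0] := eqVneq (box c r x) 0; first by rewrite mulr_ge0 ?expR_ge0.
rewrite (le_trans (box_le1 _ _ _))// /wexp -expRD leNgt expR_lt1 -leNgt.
suff : inner x x <= K by lra.
apply: ler_sum => i _; rewrite -expr2 -(real_normK (num_real (x 0 i))).
apply: lerXn2r; rewrite ?nnegrE ?addr_ge0 ?(ltW r0)//.
have [_ /(_ 0 i)] := box_ball r0 b0; rewrite /ball/= => h.
rewrite -[x 0 i](subKr (c 0 i)) (le_trans (ler_normB _ _))// lerD2l.
exact: ltW.
Qed.

Lemma iint_box n (c : 'rV[R]_n) r : 0 < r -> iint (box c r) = (r *+ 2) ^+ n.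
Proof.
move=> r0; elim: n c => [|n ih] c; first by rewrite /iint /box big_ord0.
rewrite iintS; under eq_Rintegral => t _.
  rewrite (_ : (fun v => _) = fun v => (`|c 0 0 - t| < r)%R%:R *
      box (\row_i c 0 (lift ord0 i)) r v); last first.
    apply/funext => v; rewrite /box big_ord_recl cons_row0; congr (_ * _).
    by apply: eq_bigr => i _; rewrite cons_rowS mxE.
  rewrite iintZ; last exact: gdom_box.
  rewrite ih.
  over.
rewrite /Rintegral.
transitivity (fine (\int[mu]_t ((\1_(ball (c 0 0) r) t)%:E * ((r *+ 2) ^+ n)%:E))).
  congr fine; apply: eq_integral => t _; rewrite -EFinM indicE; congr (_%:R * _)%:E.
  by rewrite mem_setE.
rewrite ge0_integralZr//; last 2 first.
- apply/measurable_EFinP; apply: measurable_indic; exact: measurable_ball.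
- by rewrite lee_fin exprn_ge0// mulrn_wge0// ltW.
rewrite integral_indic//; last exact: measurable_ball.
rewrite setIT (_ : (_ (ball _ _))%E = (r *+ 2)%:E) ?exprS//.
exact: (lebesgue_measure_ball _ (ltW r0)).
Qed.

(** The cap is replaced by the open cone [U] over it inside the unit ball. A box in [U] has explicit
    volume (2r)^(m+1), and the integrand is at least exp (k (1 - eta)) on it, so [a] does not depend
    on [k]. *)
Lemma vmf_mass_lower_bound m (c : 'rV[R]_m.+1) (eta : R) : 0 < eta ->
  sphere m c ->
  exists2 a, 0 < a & forall k, 0 <= k -> a * expR (k * (1 - eta)) <= vmf_mass k c.
Proof.
move=> eta0 cS.
pose U := [set x : 'rV[R]_m.+1 | 0 < inner x c - (1 - eta) * norm2 x] `&`
  [set x : 'rV[R]_m.+1 | norm2 x < 1].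
have oU : open U.
  apply: openI.
    apply: (@open_comp _ _ (fun x => inner x c - (1 - eta) * norm2 x) [set r | 0 < r]).
      move=> x _; apply: (@continuousB R _ _ (fun x => inner x c)
         (fun x => (1 - eta) * norm2 x)); first exact: inner_continuous.
      apply: (@continuousM R _ (fun=> 1 - eta) (@norm2 R m.+1)).
        exact: cst_continuous.
      exact: norm2_continuous.
    exact: open_gt.
  apply: (@open_comp _ _ (@norm2 R m.+1) [set r | r < 1]).
    by move=> x _; exact: norm2_continuous.
  exact: open_lt.
(* Half of [c], because [c] itself lies on the boundary of the unit ball. *)
have Uc : U (2^-1 *: c).
  have cc := (sphereE c).1 cS.
  by split; rewrite /= ?innerZl norm2Z cS ger0_norm// ?cc; lra.
have [r /= r0 rU] : nbhs_ball (2^-1 *: c) U by apply/nbhs_ballP; exact: oU.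
exists (m.+1%:R * (r *+ 2) ^+ m.+1).
  by rewrite mulr_gt0// exprn_gt0// mulrn_wgt0.
move=> k k0; rewrite -mulrA /vmf_mass sphere_integralE ler_wpM2l//.
rewrite -(iint_box (2^-1 *: c) r0) mulrC -iintZ; last exact: gdom_box.
apply: le_iint.
- by apply: gdomZ; exact: gdom_box.
- by apply: sbounded_gdom; exact: sbounded_vmf.
move=> x; rewrite /ball_ext /radial_ext.
have [->|b0] := eqVneq (box (2^-1 *: c) r x) 0.
  by rewrite mulr0; do 2 (case: ifPn => // _); exact: expR_ge0.
have [/= xc x1] := rU _ (box_ball r0 b0).
rewrite -sqr_norm2 expr_le1 ?norm2_ge0// (ltW x1).
have x0 : x != 0.
  apply/eqP => x0; move: xc; rewrite x0 inner0 (_ : norm2 _ = 0); last by apply/eqP; rewrite norm2_eq0.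
  by rewrite mulr0 subrr ltxx.
rewrite x0 (le_trans (y := expR (k * (1 - eta)) * 1))// ?ler_wpM2l ?expR_ge0 ?box_le1//.
rewrite mulr1 ler_expR ler_wpM2l// innerZl mulrC ler_pdivlMr ?norm2_gt0//.
by rewrite -subr_ge0 ltW.
Qed.

End lower_bound.

(** * Approximation by mixtures *)

Section approximation.
Variable R : realType.

(** Pythagoras: |z|^2 - <x, z>^2 is the squared norm of z - <x, z> x. *)
Lemma norm_inner_sphere_le m (x z : 'rV[R]_m.+1) : sphere m x ->
  `|inner x z| <= norm2 z.
Proof.
move=> /sphereE xx; rewrite -ler_sqr ?nnegrE ?norm2_ge0// real_normK ?num_real//.
have := inner_ge0 (z - inner x z *: x); rewrite sqr_norm2.
rewrite !innerBl !innerBr !innerZl !innerZr xx (innerC z x) expr2; lra.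
Qed.

Lemma sqr_norm2B_sphere m (x y : 'rV[R]_m.+1) : sphere m x -> sphere m y ->
  norm2 (x - y) ^+ 2 = 2 * (1 - inner x y).
Proof.
move=> /sphereE xx /sphereE yy; rewrite sqr_norm2 !innerBl !innerBr xx yy (innerC y x).
ring.
Qed.

(** Closeness is measured by the inner product, the only quantity the kernel depends on; |x - y|^2 =
    2 (1 - <x, y>) translates it into distance. *)
Lemma sphere_uniform_continuous m (f : 'rV[R]_m.+1 -> R) (e : R) :
  {within sphere m, continuous f} -> 0 < e ->
  exists2 eta, 0 < eta & forall x y, sphere m x -> sphere m y ->
    1 - eta < inner x y -> `|f x - f y| < e.
Proof.
move=> /subspace_continuousP cf e0.
pose P (eta : R) (x : 'rV[R]_m.+1) := sphere m x -> forall y, sphere m y ->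
  1 - eta < inner x y -> `|f x - f y| < e.
have cover := (@compact_near_coveringP _ _).1 (@sphere_compact R m).
have : \forall eta \near 0^'+, @sphere R m `<=` P eta.
  apply: cover => x xS.
  have e20 : 0 < e / 2 by rewrite divr_gt0.
  have /cvgrPdist_lt/(_ _ e20) := cf x xS.
  rewrite near_withinE => /nbhs_ballP[d /= d0 dP].
  have d20 : 0 < d / 2 by rewrite divr_gt0.
  (* The bound on [eta] forces |x' - y| < d/2, so that [x'] and [y] are both within [d] of the
     centre [x]. *)
  exists (ball x (d / 2), [set eta | 0 < eta /\ 2 * eta < (d / 2) ^+ 2]).
    split=> /=; first exact: nbhsx_ballx.
    near=> eta; split; first by near: eta; exact: nbhs_right_gt.
    rewrite mulrC -ltr_pdivlMr//; near: eta; apply: nbhs_right_lt.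
    by rewrite divr_gt0// exprn_gt0.
  move=> [x' eta] /= [xx' [eta0 etad]] x'S y yS xy.
  have x'y : ball x' (d / 2) y.
    rewrite -ball_normE /=; apply: le_lt_trans (mx_norm_le_norm2 _) _.
    rewrite -ltr_sqr ?nnegrE ?norm2_ge0 ?(ltW d20)// sqr_norm2B_sphere//.
    by apply: le_lt_trans etad; rewrite ler_pM2l//; lra.
  have h1 : `|f x - f x'| < e / 2.
    by apply: dP => //; apply: le_ball xx'; lra.
  have h2 : `|f x - f y| < e / 2.
    by apply: dP => //; rewrite [d]splitr; exact: ball_triangle xx' x'y.
  rewrite [e]splitr (_ : f x' - f y = (f x - f y) - (f x - f x')); last by ring.
  by rewrite (le_lt_trans (ler_normB _ _))// ltrD.
move=> h; near (0 : R)^'+ => eta; exists eta.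
  by near: eta; exact: nbhs_right_gt.
have hP : @sphere R m `<=` P eta by near: eta.
by move=> x y xS yS; apply: (hP x xS).
Unshelve. all: by end_near. Qed.

Lemma sphere_nonempty m : exists c : 'rV[R]_m.+1, sphere m c.
Proof.
by exists (cons_row 1 0); apply/sphereE; rewrite inner_cons_row inner0 addr0 mulr1.
Qed.

(** A single reference point [c] normalizes the kernels of all directions. *)
Lemma KnE m n (x y : 'rV[R]_m.+1) (c : 'rV[R]_m.+1) : (0 < m)%N -> (0 < n)%N ->
  sphere m c -> Kn m n (inner x y) = (vmf_mass n%:R c)^-1 * expR (n%:R * inner x y).
Proof. by move=> m0 n0 cS; rewrite /Kn (vmf_constE m0 _ cS)// ltr0n. Qed.

Lemma vmf_mass_gt0 m (k : R) (c : 'rV[R]_m.+1) : 0 <= k -> sphere m c ->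
  0 < vmf_mass k c.
Proof.
move=> k0 cS; have [a a0 /(_ k k0)] := vmf_mass_lower_bound (@ltr01 R) cS.
by apply: lt_le_trans; rewrite mulr_gt0// expR_gt0.
Qed.

Lemma sbounded_Kn m n (x : 'rV[R]_m.+1) : sbounded (fun y => Kn m n (inner y x)).
Proof. by rewrite /Kn; apply: sboundedZ; exact: sbounded_vmf. Qed.

Lemma vmf_convolution_approx m (f : 'rV[R]_m.+1 -> R) (e : R) : (0 < m)%N ->
  {within sphere m, continuous f} -> 0 < e ->
  exists2 n, (0 < n)%N & forall x, sphere m x ->
    `|f x - sphere_integral (fun y => f y * Kn m n (inner y x))| <= e.
Proof.
move=> m0 cf e0; have bf := sbounded_continuous cf.
have [_ [C fC]] := bf; have [c cS] := @sphere_nonempty m.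
have e20 : 0 < e / 2 by rewrite divr_gt0.
have [eta eta0 feta] := sphere_uniform_continuous cf e20.
have eta20 : 0 < eta / 2 by rewrite divr_gt0.
have [a a0 ha] := vmf_mass_lower_bound eta20 cS.
have C0 : 0 <= C by apply: le_trans (fC c cS).
pose V := sphere_integral (fun _ : 'rV[R]_m.+1 => 1 : R).
pose D := 2 * C * V / a.
pose n := (Num.trunc (D / (eta / 2 * (e / 2)))).+1.
have nD : D <= n%:R * (eta / 2 * (e / 2)).
  by rewrite -ler_pdivrMr ?mulr_gt0//; apply/ltW; exact: truncnS_gt.
exists n => // x xS.
have n0 : 0 <= n%:R :> R by [].
set A := vmf_mass n%:R c.
have A0 : 0 < A by exact: vmf_mass_gt0.
(* Both masses are inverses of the same [vmf_const]; this replaces rotation invariance. *)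
have AE y : sphere m y -> vmf_mass n%:R y = A.
  move=> yS; apply: invr_inj; rewrite -!vmf_constE//.
have KE y : Kn m n (inner y x) = A^-1 * expR (n%:R * inner y x) by exact: KnE.
have fxE : f x = sphere_integral (fun y => f x * Kn m n (inner y x)).
  rewrite sphere_integralZ; last exact: sbounded_Kn.
  under eq_fun do rewrite KE; rewrite sphere_integralZ; last exact: sbounded_vmf.
  by rewrite -/(vmf_mass _ _) AE// mulVf ?mulr1// gt_eqF.
rewrite {1}fxE -sphere_integralB; last 2 first.
- by apply: sboundedZ; exact: sbounded_Kn.
- by apply: sboundedM => //; exact: sbounded_Kn.
(* On the cap 1 - eta < <x, y> the values of [f] differ by less than e/2; off it they differ by at
   most 2 C while the kernel is at most exp (n (1 - eta)) / A. *)
pose B := A^-1 * (2 * C * expR (n%:R * (1 - eta))).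
have : `|sphere_integral (fun y => f x * Kn m n (inner y x) - f y * Kn m n (inner y x))| <=
    sphere_integral (fun y => e / 2 * Kn m n (inner y x) + B * 1).
  apply: ler_norm_sphere_integral.
  - under eq_fun do rewrite -mulrBl; apply: sboundedM; last exact: sbounded_Kn.
    under eq_fun do rewrite -[- f _]mulN1r.
    by apply: sboundedD; [exact: sbounded_cst|exact: sboundedZ].
  - apply: sboundedD; apply: sboundedZ; [exact: sbounded_Kn|exact: sbounded_cst].
  move=> y yS; rewrite -mulrBl normrM KE [X in _ * X]ger0_norm; last first.
    by rewrite mulr_ge0 ?expR_ge0// invr_ge0 ltW.
  rewrite mulr1 /B mulrCA [e / 2 * _]mulrCA -mulrDr ler_pM2l ?invr_gt0//.
  have [xy|xy] := ltP (1 - eta) (inner x y).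
    rewrite ler_wpDr// ?mulr_ge0 ?expR_ge0//.
    by rewrite ler_wpM2r ?expR_ge0// ltW// feta.
  apply: ler_wpDl; first exact: mulr_ge0 (ltW e20) (expR_ge0 _).
  rewrite ler_pM ?expR_ge0//; last by rewrite ler_expR ler_wpM2l// innerC.
  by rewrite (le_trans (ler_normB _ _))// mulr_natl mulr2n lerD ?fC.
move=> /le_trans; apply.
rewrite sphere_integralD; last 2 first.
- by apply: sboundedZ; exact: sbounded_Kn.
- by apply: sboundedZ; exact: sbounded_cst.
rewrite (sphere_integralZ (e / 2)); last exact: sbounded_Kn.
rewrite (sphere_integralZ B); last exact: sbounded_cst.
have -> : sphere_integral (fun y => Kn m n (inner y x)) = 1.
  under eq_fun do rewrite KE; rewrite sphere_integralZ; last exact: sbounded_vmf.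
  by rewrite -/(vmf_mass _ _) AE// mulVf// gt_eqF.
rewrite mulr1 -/V [leRHS]splitr lerD2l /B -[leLHS]mulrA ler_pdivrMl// [leRHS]mulrC.
apply: (@le_trans _ _ (e / 2 * (a * expR (n%:R * (1 - eta / 2))))); last first.
  by rewrite ler_wpM2l ?(ltW e20)//; exact: ha.
rewrite (_ : n%:R * (1 - eta / 2) = n%:R * (eta / 2) + n%:R * (1 - eta)); last by field.
rewrite expRD.
set E := expR (n%:R * (1 - eta)); set F := expR _.
have F1 : n%:R * (eta / 2) <= F by apply: le_trans (expR_ge1Dx _); rewrite lerDr.
have E0 : 0 <= E by exact: expR_ge0.
have nF : D <= F * (e / 2).
  by apply: le_trans nD _; rewrite mulrA ler_wpM2r// ltW.
have /(ler_wpM2r E0) : 2 * C * V <= F * (e / 2) * a by rewrite -ler_pdivrMr.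
by congr (_ <= _); ring.
Qed.

Lemma norm2B_continuous n (y : 'rV[R]_n) :
  continuous (fun x : 'rV[R]_n => norm2 (x - y)).
Proof.
move=> x.
apply: (@continuous_comp _ _ _ (fun x : 'rV[R]_n => x - y) (@norm2 R n)).
  by apply: (@continuousB R _ _ id (fun=> y)) => //; exact: cst_continuous.
exact: norm2_continuous.
Qed.

(** * Discretization of the convolution by a finite net *)

Lemma sphere_net m (r : R) : 0 < r ->
  exists (N : nat) (y : 'I_N -> 'rV[R]_m.+1), (forall k, sphere m (y k)) /\
    forall x, sphere m x -> exists k, norm2 (x - y k) < r.
Proof.
move=> r0; have := @sphere_compact R m; rewrite compact_cover => cov.
have [||D DS Dcov] := cov 'rV[R]_m.+1 (sphere m) (fun y => [set x | norm2 (x - y) < r]).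
- move=> y _.
  apply: (@open_comp _ _ (fun x : 'rV[R]_m.+1 => norm2 (x - y)) [set t | t < r]).
    by move=> x _; exact: norm2B_continuous.
  exact: open_lt.
- move=> x xS; exists x => //=; rewrite subrr (_ : norm2 0 = 0)//.
  by apply/eqP; rewrite norm2_eq0.
exists (size (finmap.enum_fset D)), (fun k => tnth (in_tuple (finmap.enum_fset D)) k).
split=> [k|x /Dcov [y yD xy]].
  by have := DS _ (mem_tnth k (in_tuple (finmap.enum_fset D))); rewrite inE.
have /tnthP[k yk] : y \in in_tuple (finmap.enum_fset D) by [].
by exists k; rewrite -yk.
Qed.

Lemma expR_lipschitz (a b k : R) : a <= k -> b <= k ->
  `|expR a - expR b| <= expR k * `|a - b|.
Proof.
wlog ab : a b / b <= a.
  move=> h ak bk; have [/h|/ltW/h] := leP b a; first exact.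
  by rewrite distrC [`|a - b|]distrC; exact.
move=> ak bk; rewrite !ger0_norm ?subr_ge0 ?ler_expR//.
apply: (@le_trans _ _ (expR a * (a - b))); last first.
  by rewrite ler_wpM2r ?subr_ge0// ler_expR.
(* Multiplying exp (b - a) >= 1 + b - a by exp a gives the tangent bound. *)
have := expR_ge1Dx (b - a); rewrite expRB ler_pdivlMr ?expR_gt0//; lra.
Qed.

Lemma continuous_bump n (y : 'rV[R]_n) (r : R) :
  continuous (fun x : 'rV[R]_n => Num.max 0 (r - norm2 (x - y))).
Proof.
move=> x; apply: (@continuous_max _ _ (fun=> 0) (fun x : 'rV[R]_n => r - norm2 (x - y))).
  exact: cst_continuous.
apply: (@continuousB R _ _ (fun=> r) (fun x : 'rV[R]_n => norm2 (x - y))).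
  exact: cst_continuous.
exact: norm2B_continuous.
Qed.

(* A partition of unity subordinate to a fine net turns the convolution into
   a finite mixture with the same total mass. *)
Lemma vmf_mixture_approx m n (f : 'rV[R]_m.+1 -> R) (e : R) : (0 < m)%N ->
  (0 < n)%N -> sbounded f -> (forall x, sphere m x -> 0 <= f x) ->
  sphere_integral f = 1 -> 0 < e ->
  exists (N : nat) (y : 'I_N -> 'rV[R]_m.+1) (c : 'I_N -> R),
    [/\ forall k, sphere m (y k), forall k, 0 <= c k, \sum_(k < N) c k = 1 &
    forall x, sphere m x ->
      `|sphere_integral (fun y => f y * Kn m n (inner y x)) -
        \sum_(k < N) c k * Kn m n (inner x (y k))| <= e].
Proof.
move=> m0 n0 bf f0 f1 e0; have [c0 c0S] := @sphere_nonempty m.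
pose A := vmf_mass n%:R c0.
have A0 : 0 < A by apply: vmf_mass_gt0.
(* A Lipschitz constant of the kernel on the sphere: u -> exp (n u) has slope at most n exp n for u
   <= 1. *)
pose L := A^-1 * (expR n%:R * n%:R).
have L0 : 0 < L by rewrite !mulr_gt0 ?invr_gt0 ?expR_gt0 ?ltr0n.
have KL x y z : sphere m x -> sphere m y -> sphere m z ->
    `|Kn m n (inner y x) - Kn m n (inner x z)| <= L * norm2 (y - z).
  move=> xS yS zS; rewrite (innerC x z) !(KnE _ _ m0 n0 c0S) -/A -mulrBr normrM.
  rewrite gtr0_norm ?invr_gt0// /L -mulrA ler_pM2l ?invr_gt0//.
  have le_n (u : 'rV[R]_m.+1) : sphere m u -> n%:R * inner u x <= n%:R :> R.
    move=> uS; rewrite ler_piMr// (le_trans (ler_norm _))//.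
    exact: inner_sphere.
  rewrite (le_trans (expR_lipschitz (le_n _ yS) (le_n _ zS)))//.
  rewrite -mulrA ler_wpM2l ?expR_ge0// -mulrBr normrM normr_nat ler_wpM2l//.
  by rewrite -innerBl innerC norm_inner_sphere_le.
(* At this mesh the kernel varies by at most [e] on the support of each bump. *)
pose r := e / L; have r0 : 0 < r by rewrite divr_gt0.
have [N [y [yS ynet]]] := @sphere_net m r r0.
pose phi k x := Num.max 0 (r - norm2 (x - y k)).
pose Phi x := \sum_(k < N) phi k x.
have phi0 k x : 0 <= phi k x by rewrite /phi le_max lexx.
have Phi0 x : sphere m x -> 0 < Phi x.
  move=> /ynet [k xk]; rewrite /Phi (bigD1 k)//=; apply: ltr_pwDl; last exact: sumr_ge0.
  by rewrite /phi lt_max subr_gt0 xk orbT.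
pose psi k x := phi k x / Phi x.
have psi0 k x : sphere m x -> 0 <= psi k x.
  by move=> xS; rewrite divr_ge0// ltW// Phi0.
have psi1 x : sphere m x -> \sum_(k < N) psi k x = 1.
  by move=> xS; rewrite -mulr_suml mulfV// gt_eqF// Phi0.
have bpsi k : sbounded (psi k).
  (* [Phi] may vanish away from the sphere, so continuity is claimed at points of the sphere
     only. *)
  apply: sbounded_continuous; apply: continuous_in_subspaceT => x /[!inE] xS.
  apply: (@continuousM R _ (phi k) (fun x => (Phi x)^-1)); first exact: continuous_bump.
  apply: continuousV; first by rewrite gt_eqF// Phi0.
  by apply: continuous_sum_ord => j; exact: continuous_bump.
have bfpsi k : sbounded (fun x => f x * psi k x) by exact: sboundedM.
exists N, y, (fun k => sphere_integral (fun x => f x * psi k x)); split => //.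
- move=> k; have -> : 0 = sphere_integral (fun _ : 'rV[R]_m.+1 => 0 * 1 : R).
    by rewrite sphere_integralZ ?mul0r//; exact: sbounded_cst.
  apply: le_sphere_integral => // [|x xS]; first by apply: sboundedZ; exact: sbounded_cst.
  by rewrite mul0r mulr_ge0 ?f0 ?psi0.
- rewrite -sphere_integral_sum// -f1; apply: eq_sphere_integral => x xS.
  by rewrite -mulr_sumr psi1// mulr1.
move=> x xS; under eq_bigr do rewrite mulrC -sphere_integralZ//.
rewrite -sphere_integral_sum; last by move=> k; exact: sboundedZ.
rewrite -sphere_integralB; last 2 first.
- by apply: sboundedM => //; exact: sbounded_Kn.
- by apply: sbounded_sum => k; exact: sboundedZ.
rewrite -[leRHS]mulr1 -f1 -sphere_integralZ//.
apply: ler_norm_sphere_integral.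
- under eq_fun do rewrite -[- (\sum_(i < N) _)]mulN1r.
  apply: sboundedD; first by apply: sboundedM => //; exact: sbounded_Kn.
  by apply: sboundedZ; apply: sbounded_sum => k; exact: sboundedZ.
- exact: sboundedZ.
move=> z zS.
have -> : f z * Kn m n (inner z x) - \sum_(k < N) Kn m n (inner x (y k)) * (f z * psi k z) =
    \sum_(k < N) f z * psi k z * (Kn m n (inner z x) - Kn m n (inner x (y k))).
  rewrite -[X in X * _ - _]mulr1 -(psi1 z zS) mulr_sumr mulr_suml -sumrB.
  by apply: eq_bigr => k _; ring.
apply: (le_trans (ler_norm_sum _ _ _)).
have -> : e * f z = \sum_(k < N) f z * psi k z * e.
  by rewrite -mulr_suml -mulr_sumr psi1// mulr1 mulrC.
apply: ler_sum => k _; have fp0 := mulr_ge0 (f0 z zS) (psi0 k z zS).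
rewrite normrM [X in X * _]ger0_norm//.
(* Near [y k] the Lipschitz bound applies; farther away the bump is 0 and so is the term. *)
have [zk|zk] := ltP (norm2 (z - y k)) r.
  rewrite ler_wpM2l// (le_trans (KL _ _ _ xS zS (yS k)))//.
  by rewrite mulrC -ler_pdivlMr// ltW.
by rewrite /psi /phi max_l ?subr_le0// mul0r mulr0 !mul0r.
Qed.

(** A weight of the partition is 0 when [f] vanishes on the support of its bump, whereas the mixture
    must have positive weights. Enumerating the support of [c] drops these indices without changing
    any weighted sum, and total mass 1 keeps the support nonempty. *)
Lemma positive_weights (N : nat) (c : 'I_N -> R) :
  (forall k, 0 <= c k) -> \sum_(k < N) c k = 1 ->
  exists (M : nat) (s : 'I_M -> 'I_N), [/\ (0 < M)%N, forall k, 0 < c (s k) &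
    forall F : 'I_N -> R, \sum_(k < M) c (s k) * F (s k) = \sum_(k < N) c k * F k].
Proof.
move=> c0 c1; pose P := [pred k | 0 < c k].
have sE (F : 'I_N -> R) : \sum_(k < #|P|) c (enum_val k) * F (enum_val k) =
    \sum_(k < N) c k * F k.
  rewrite -[LHS](big_enum_val (fun k => c k * F k)) [RHS](bigID P)/= [X in _ + X]big1 ?addr0//.
  move=> k; rewrite -leNgt => ck.
  by rewrite (_ : c k = 0) ?mul0r//; apply/eqP; rewrite eq_le ck c0.
exists #|P|, (fun k => enum_val k); split => //.
  rewrite lt0n; apply/eqP => P0; have : \sum_(k < N) c k * 1 = 0.
    rewrite -(sE (fun=> 1)); apply: big1 => k _.
    by have := ltn_ord k; rewrite [X in (_ < X)%N]P0.
  under eq_bigr do rewrite mulr1.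
  by rewrite c1 => /eqP; rewrite oner_eq0.
by move=> k; have := enum_valP k; rewrite inE.
Qed.

End approximation.

Theorem theorem1 (R : realType) (m : nat) (hm : (1 <= m)%N)
  (f : 'rV[R]_(m.+1) -> R)
  (hcont : {within sphere m, continuous f})
  (hpos : forall x, sphere m x -> 0 <= f x)
  (hint : sphere_integral f = 1) :
  forall delta : R, 0 < delta ->
  exists (n N : nat) (y : 'I_N -> 'rV[R]_(m.+1)) (c : 'I_N -> R),
    (0 < n)%N /\ (0 < N)%N /\
        (forall k, sphere m (y k)) /\
        (forall k, 0 < c k) /\
        \sum_(k < N) c k = 1 /\
        (forall x, sphere m x ->
          `| f x - \sum_(k < N) c k * Kn m n (inner x (y k)) | < delta).
Proof.
(* Two errors of at most d/3 leave room for the strict inequality. *)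
move=> d d0; have d30 : 0 < d / 3 by rewrite divr_gt0.
have [n n0 hn] := vmf_convolution_approx hm hcont d30.
have [N [y [c [yS c0 c1 hc]]]] :=
  vmf_mixture_approx hm n0 (sbounded_continuous hcont) hpos hint d30.
have [M [s [M0 cs0 sE]]] := positive_weights c0 c1.
exists n, M, (y \o s), (c \o s); split=> //; split=> //; split=> [k|]; first exact: yS.
split=> //; split.
  rewrite -c1; have := sE (fun=> 1).
  under eq_bigr do rewrite mulr1; under [X in _ = X]eq_bigr do rewrite mulr1.
  exact.
move=> x xS; rewrite (sE (fun k => Kn m n (inner x (y k)))).
have h1 := hn x xS; have h2 := hc x xS.
set J := sphere_integral _ in h1 h2; set S := \sum_(k < N) _ in h2 *.
rewrite (_ : f x - S = (f x - J) + (J - S)); last by ring.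
by rewrite (le_lt_trans (ler_normD _ _))// (le_lt_trans (lerD h1 h2))//; lra.
Qed.
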